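(* Let $\rho:\pi_1^{\mathrm{orb}}(T^8/\Gamma)\to SO(8)$ be a representation with $\rho(\alpha)=\rho(\beta)=1$ and such that $\rho(\gamma)$ and $\rho(\delta)$ commute, with at least one of them non-trivial. If $\rho(\tau_4),\rho(\tau_5),\rho(\tau_8)$ are gauge equivalent (i.e. simultaneously conjugate by a change of basis) to the diagonal matrices with entries $$(-1,-1,-1,-1,1,1,1,1),\quad(-1,-1,1,1,-1,-1,1,1),\quad(1,-1,-1,1,1,-1,-1,1),$$ then $\rho$ is valid for the construction, i.e. the associated flat connection is irreducible, infinitesimally rigid and unobstructed.
   Context: $\pi_1^{\mathrm{orb}}(T^8/\Gamma)$ is the group of affine isometries of $\mathbb R^8$ generated by $\alpha:(x_1,\dots,x_8)\mapsto(-x_1,-x_2,-x_3,-x_4,x_5,x_6,x_7,x_8)$, $\beta:\ \mapsto(x_1,x_2,x_3,x_4,-x_5,-x_6,-x_7,-x_8)$, $\gamma:\ \mapsto(\frac12-x_1,\frac12-x_2,x_3,x_4,\frac12-x_5,\frac12-x_6,x_7,x_8)$, $\delta:\ \mapsto(-x_1,x_2,\frac12-x_3,x_4,\frac12-x_5,x_6,\frac12-x_7,x_8)$, and the unit translations $\tau_i:x_i\mapsto x_i+1$ ($i=1,\dots,8$). $\Gamma$ is the group generated by $\alpha,\beta,\gamma,\delta$ acting on $T^8=\mathbb R^8/\mathbb Z^8$. The flat $Spin(7)$-structure on $T^8/\Gamma$ is (with $dx_{ijkl}=dx_i\wedge dx_j\wedge dx_k\wedge dx_l$) $\Omega_0=dx_{1234}+dx_{1256}+dx_{1278}+dx_{1357}-dx_{1368}-dx_{1458}-dx_{1467}-dx_{2358}-dx_{2367}-dx_{2457}+dx_{2468}+dx_{3456}+dx_{3478}+dx_{5678}$;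 $\Lambda^2_7$ is the rank 7 eigenspace of $\omega\mapsto*(\Omega_0\wedge\omega)$ on 2-forms with eigenvalue $3$, and $\pi^2_7$ the orthogonal projection onto it. A homomorphism $\rho$ to $G$ determines an orbifold $G$-bundle $E_0=(\mathbb R^8\times G)/\pi_1^{\mathrm{orb}}(T^8/\Gamma)$ over $T^8/\Gamma$ with flat connection $\theta$, the flat connection associated with $\rho$. Let $\mathcal H^i_\theta$ be the cohomology of $0\to\Gamma(\mathrm{Ad}E_0)\xrightarrow{d_\theta}\Gamma(\Lambda^1\otimes\mathrm{Ad}E_0)\xrightarrow{\pi^2_7d_\theta}\Gamma(\Lambda^2_7\otimes\mathrm{Ad}E_0)\to0$ (sections on the orbifold are the equivariant ones upstairs). $\theta$ is irreducible if $\mathcal H^0_\theta=0$, infinitesimally rigid if $\mathcal H^1_\theta=0$, unobstructed if $\mathcal H^2_\theta=0$. *)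

(* Defs.v *)
From HB Require Import structures.
From mathcomp Require Import all_boot all_order all_algebra.
From mathcomp Require Import all_classical all_reals all_analysis.
Set Implicit Arguments.
Unset Strict Implicit.
Unset Printing Implicit Defensive.
Import Order.TTheory GRing.Theory Num.Theory.
Import numFieldNormedType.Exports.
Local Open Scope classical_set_scope.
Local Open Scope ring_scope.

(* Points of R^8 are row vectors.  The coordinate x_n (1 <= n <= 8) is the
   entry of index n-1; numerals such as [:: 1; 2; 5; 6] below are 1-based. *)

Section Forms.
Variable R : realType.

Definition e (i : 'I_8) : 'rV[R]_8 := delta_mx 0 i.

(* Exterior algebra of (R^8)^* with coefficients in V: the value of w at
   I = {i1 < ... < ik} is the coefficient of dx_i1 /\ ... /\ dx_ik. *)
Definition ext (V : Type) := {ffun {set 'I_8} -> V}.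

(* sign of the shuffle that sorts the concatenation of I and J *)
Definition shuffle_sign (I J : {set 'I_8}) : R :=
  (-1) ^+ #|[set p : 'I_8 * 'I_8 | [&& p.1 \in I, p.2 \in J & (p.2 < p.1)%N]]%SET|.

Definition wedge (V : lmodType R) (a : ext R) (w : ext V) : ext V :=
  [ffun K : {set 'I_8} => \sum_(I : {set 'I_8} | I \subset K)
     (shuffle_sign I (K :\: I) * a I) *: w (K :\: I)].

(* Hodge star of the Euclidean metric and the orientation dx_{12345678}:
   * dx_I is the signed dx_J, J the complement of I, with
   dx_I /\ * dx_I = dx_{12345678}. *)
Definition star (V : lmodType R) (w : ext V) : ext V :=
  [ffun K : {set 'I_8} => shuffle_sign (~: K) K *: w (~: K)].

Definition of_degree (V : lmodType R) (k : nat) (w : ext V) : Prop :=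
  forall I : {set 'I_8}, #|I| != k -> w I = 0.

Definition dxI (I : {set 'I_8}) : ext R := [ffun J => (J == I)%:R].

(* dx_ [:: i; j; k; l]%N is dx_i /\ dx_j /\ dx_k /\ dx_l for i < j < k < l *)
Definition dx_ (s : seq nat) : ext R := dxI [set i : 'I_8 | i.+1 \in s]%SET.

Definition Omega0 : ext R :=
    dx_ [:: 1; 2; 3; 4]%N + dx_ [:: 1; 2; 5; 6]%N + dx_ [:: 1; 2; 7; 8]%N
  + dx_ [:: 1; 3; 5; 7]%N - dx_ [:: 1; 3; 6; 8]%N - dx_ [:: 1; 4; 5; 8]%N
  - dx_ [:: 1; 4; 6; 7]%N - dx_ [:: 2; 3; 5; 8]%N - dx_ [:: 2; 3; 6; 7]%N
  - dx_ [:: 2; 4; 5; 7]%N + dx_ [:: 2; 4; 6; 8]%N + dx_ [:: 3; 4; 5; 6]%N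
  + dx_ [:: 3; 4; 7; 8]%N + dx_ [:: 5; 6; 7; 8]%N.

(* Lambda^2_7 (x) V *)
Definition Lambda27 (V : lmodType R) (w : ext V) : Prop :=
  of_degree 2 w /\ star (wedge Omega0 w) = 3%:R *: w.

(* The V-valued pairing of a scalar form with a V-valued one; the dx_I are
   orthonormal. *)
Definition pairing (V : lmodType R) (z : ext R) (w : ext V) : V :=
  \sum_(I : {set 'I_8}) z I *: w I.

Definition is_orthproj27 (V : lmodType R) (w p : ext V) : Prop :=
  Lambda27 p /\ forall z : ext R, Lambda27 (z : ext R^o) -> pairing z (w - p) = 0.

(* orthogonal projection of a 2-form onto Lambda^2_7 (x) V *)
Definition pi27 (V : lmodType R) (w : ext V) : ext V :=
  xget 0 [set p | is_orthproj27 w p].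

(* Derivative along the i-th coordinate, coefficientwise. *)
Definition pderiv (V : normedModType R) (i : 'I_8) (w : 'rV[R]_8 -> ext V)
    (x : 'rV[R]_8) : ext V :=
  [ffun I => derive (fun y => w y I) x (e i)].

(* d w = sum_i dx_i /\ d_i w *)
Definition extd (V : normedModType R) (w : 'rV[R]_8 -> ext V)
    (x : 'rV[R]_8) : ext V :=
  \sum_(i < 8) wedge (dxI [set i]%SET) (pderiv i w x).

Definition iter_partial (V : normedModType R) (s : seq 'I_8)
    (f : 'rV[R]_8 -> V) : 'rV[R]_8 -> V :=
  foldr (fun i h => fun x => derive h x (e i)) f s.

(* C^oo: all iterated partial derivatives are (Frechet) differentiable. *)
Definition smooth (V : normedModType R) (f : 'rV[R]_8 -> V) : Prop :=
  forall (s : seq 'I_8) (x : 'rV[R]_8), differentiable (iter_partial s f) x.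

(* g^* dx_i at x, i.e. the differential of the i-th component of g *)
Definition pull_dx (g : 'rV[R]_8 -> 'rV[R]_8) (x : 'rV[R]_8) (i : 'I_8) : ext R :=
  \sum_(j < 8) (derive g x (e j) 0 i) *: (dxI [set j]%SET : ext R^o).

(* g^* dx_I, the wedge product of the g^* dx_i for i in I (enum is increasing) *)
Definition pull_dxI (g : 'rV[R]_8 -> 'rV[R]_8) (x : 'rV[R]_8)
    (I : {set 'I_8}) : ext R :=
  foldr (fun i (a : ext R^o) => wedge (pull_dx g x i) a) (dxI finset.set0) (enum I).

Definition pullback (V : lmodType R) (g : 'rV[R]_8 -> 'rV[R]_8)
    (w : 'rV[R]_8 -> ext V) (x : 'rV[R]_8) : ext V :=
  [ffun J => \sum_(I : {set 'I_8}) pull_dxI g x I J *: w (g x) I].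

End Forms.

Section OrbifoldGroup.
Variable R : realType.
Notation R8 := 'rV[R]_8.

(* x_i |-> s_i x_i + b_i *)
Definition diag_affine (s b : seq R) (x : R8) : R8 :=
  \row_i (s`_i * x 0 i + b`_i).

Definition alpha : R8 -> R8 :=
  diag_affine [:: -1; -1; -1; -1; 1; 1; 1; 1] [:: 0; 0; 0; 0; 0; 0; 0; 0].
Definition beta : R8 -> R8 :=
  diag_affine [:: 1; 1; 1; 1; -1; -1; -1; -1] [:: 0; 0; 0; 0; 0; 0; 0; 0].
Definition gamma : R8 -> R8 :=
  diag_affine [:: -1; -1; 1; 1; -1; -1; 1; 1]
              [:: 2^-1; 2^-1; 0; 0; 2^-1; 2^-1; 0; 0].
Definition delta : R8 -> R8 :=
  diag_affine [:: -1; 1; -1; 1; -1; 1; -1; 1]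
              [:: 0; 0; 2^-1; 0; 2^-1; 0; 2^-1; 0].

(* the unit translation x_n |-> x_n + 1, 1 <= n <= 8 *)
Definition tau (n : nat) (x : R8) : R8 := \row_i (x 0 i + (i.+1 == n)%:R).

(* pi_1^orb(T^8/Gamma) as a group of transformations of R^8 *)
Inductive pi1orb : (R8 -> R8) -> Prop :=
| pi1_alpha : pi1orb alpha
| pi1_beta : pi1orb beta
| pi1_gamma : pi1orb gamma
| pi1_delta : pi1orb delta
| pi1_tau n : (1 <= n <= 8)%N -> pi1orb (tau n)
| pi1_id : pi1orb id
| pi1_comp g h : pi1orb g -> pi1orb h -> pi1orb (g \o h)
| pi1_inv g h : pi1orb g -> cancel g h -> cancel h g -> pi1orb h.

Definition SO8 (A : 'M[R]_8) : Prop := A *m A^T = 1%:M /\ \det A = 1.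

(* A representation is a total function of which only the values on the group
   matter. *)
Definition is_rep (rho : (R8 -> R8) -> 'M[R]_8) : Prop :=
  (forall g, pi1orb g -> SO8 (rho g)) /\
  (forall g h, pi1orb g -> pi1orb h -> rho (g \o h) = rho g *m rho h).

Definition diag8 (s : seq R) : 'M[R]_8 := diag_mx (\row_i s`_i).

(* Simultaneous conjugacy of two triples by a change of basis of R^8. *)
Definition simul_conj3 (A1 A2 A3 B1 B2 B3 : 'M[R]_8) : Prop :=
  exists2 P : 'M[R]_8, P \in unitmx &
    [/\ invmx P *m A1 *m P = B1, invmx P *m A2 *m P = B2
      & invmx P *m A3 *m P = B3].

End OrbifoldGroup.

Section DeformationComplex.
Variable R : realType.
Notation R8 := 'rV[R]_8.
Variable rho : (R8 -> R8) -> 'M[R]_8.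

(* Smooth sections over T^8/Gamma of Lambda^k (x) Ad E_0: so(8)-valued k-forms
   upstairs with g^* w = Ad(rho g) w, since g acts on R^8 x SO(8) by
   (x, h) |-> (g x, rho(g) h). *)
Definition form_section (k : nat) (w : R8 -> ext 'M[R]_8) : Prop :=
  [/\ forall I, smooth (fun x => w x I),
      forall x, of_degree k (w x),
      forall x I, (w x I)^T = - w x I
    & forall g, pi1orb g -> forall x,
        pullback g w x = [ffun I => rho g *m w x I *m invmx (rho g)]].

Definition form_section27 (w : R8 -> ext 'M[R]_8) : Prop :=
  form_section 2 w /\ forall x, Lambda27 (w x).

(* The flat connection theta is induced by the product connection on
   R^8 x SO(8), so d_theta is the exterior derivative upstairs. *)
Definition d_theta (w : R8 -> ext 'M[R]_8) : R8 -> ext 'M[R]_8 := extd w.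

Definition pi27_d_theta (w : R8 -> ext 'M[R]_8) : R8 -> ext 'M[R]_8 :=
  fun x => pi27 (d_theta w x).

(* Cocycles and coboundaries of the deformation complex; the cohomology in
   degree i is Zi / Bi, and it vanishes iff Zi is contained in Bi. *)
Definition Z0 : set (R8 -> ext 'M[R]_8) :=
  [set f | form_section 0 f /\ d_theta f = 0].
Definition B0 : set (R8 -> ext 'M[R]_8) := [set 0].
Definition Z1 : set (R8 -> ext 'M[R]_8) :=
  [set a | form_section 1 a /\ pi27_d_theta a = 0].
Definition B1 : set (R8 -> ext 'M[R]_8) := d_theta @` [set f | form_section 0 f].
Definition Z2 : set (R8 -> ext 'M[R]_8) := [set w | form_section27 w].
Definition B2 : set (R8 -> ext 'M[R]_8) :=
  pi27_d_theta @` [set a | form_section 1 a].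

Definition flat_irreducible : Prop := Z0 `<=` B0.
Definition flat_infinitesimally_rigid : Prop := Z1 `<=` B1.
Definition flat_unobstructed : Prop := Z2 `<=` B2.

End DeformationComplex.

(* Main.v *)
(* Let T_i = rho(tau_i).  Conjugating tau_i by alpha or beta gives T_i^2 = 1,
   and every group element commutes with each tau_i up to inversion, so rho(g)
   commutes with T_4, T_5, T_8.  The eight joint characters of these three
   involutions are distinct; hence in the given basis every rho(g) is
   diagonal, skew matrices have zero diagonal, and each off-diagonal
   entry of an so(8)-valued section is a 2-periodic function which changes sign
   under a unit translation in one of the directions 4, 5, 8.

   On such scalar functions the Laplacian is bijective.  A reflection coupling
   gives |u| <= |Delta u| / 8, also for the discrete Laplacian with step
   1/(2m).  This bound applies to all derivatives, so truncated Jacobi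
   iterations for the discrete equations are Cauchy in every C^k norm and
   converge to a smooth solution of Delta u = f.

   A parallel section is harmonic, hence zero.  If pi_7(da) = 0, then
   Delta a_i = d_i(div a), so solving Delta f = div a makes a - df harmonic and
   a = df.  For w in Lambda^2_7, solving Delta v = w and putting
   a_j = 4 sum_m d_m v_{mj} gives pi_7(da) = w.  Uniqueness makes the solutions
   equivariant under the whole group. *)
Require Import Defs.
From HB Require Import structures.
From mathcomp Require Import all_boot all_order all_algebra.
From mathcomp Require Import all_classical all_reals all_analysis.
From mathcomp Require Import ring lra.
Set Implicit Arguments.
Unset Strict Implicit.
Unset Printing Implicit Defensive.
Import Order.TTheory GRing.Theory Num.Theory.
Import numFieldNormedType.Exports.
Local Open Scope classical_set_scope.
Local Open Scope ring_scope.

(** * Smooth functions on R^8 *)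

(** Read as skew matrices, the seven forms eta_n spanning Lambda^2_7 are anticommuting complex
    structures J_n, so for every covector xi the vectors xi, J_1 xi, ..., J_7 xi are orthogonal of
    length |xi|. Expanding a vector in this frame is, on symbols, the identity for Delta a_i behind
    rigidity; orthogonality of the J_n xi is the one behind surjectivity. The given basis is not
    assumed orthonormal. The T_k are orthogonal involutions, hence symmetric, which makes its Gram
    matrix commute with the three diagonal matrices and so be diagonal; this is why skewness still
    kills the diagonal entries. The analysis uses sup norms only. A term eps u makes the Jacobi step
    a contraction, while the maximum principle supplies bounds independent of eps, so eps and the
    mesh can tend to zero together. The truncation depends on the mesh alone, and one sequence of
    approximations serves all derivatives. *)

Section Calculus.
Variable R : realType.
Notation R8 := 'rV[R]_8.
Local Notation e := (@e R).

Lemma mx_linear_continuous (m n : nat) (W : normedModType R)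
    (L : {linear 'M[R]_(m, n) -> W}) : continuous L.
Proof.
have LE : (L : 'M[R]_(m, n) -> W) =
    fun M => \sum_(p : 'I_m * 'I_n) M p.1 p.2 *: L (delta_mx p.1 p.2).
  apply/funext => M; rewrite {1}(matrix_sum_delta M) linear_sum.
  rewrite -(pair_bigA _ (fun i j => M i j *: L (delta_mx i j))) /=.
  apply: eq_bigr => i _; rewrite linear_sum; apply: eq_bigr => j _.
  exact: linearZ.
have cM i j (c : W) : continuous (fun M : 'M[R]_(m, n) => (M i j : R) *: c).
  move=> M; apply: differentiable_continuous.
  by apply: differentiableZl; exact: differentiable_coord.
rewrite LE; apply: continuous_big => [|p _]; first exact: add_continuous.
exact: cM.
Qed.

Definition pd (V : normedModType R) (i : 'I_8) (f : R8 -> V) : R8 -> V :=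
  fun x => 'D_(e i) f x.

Lemma iter_partial_cons (V : normedModType R) i s (f : R8 -> V) :
  iter_partial (i :: s) f = pd i (iter_partial s f).
Proof. by []. Qed.

Lemma iter_partial_pd (V : normedModType R) i s (f : R8 -> V) :
  iter_partial s (pd i f) = iter_partial (rcons s i) f.
Proof. by rewrite /iter_partial foldr_rcons. Qed.

Section Smooth.
Variables V W : normedModType R.
Implicit Types f g : R8 -> V.

Lemma smooth_differentiable f x : smooth f -> differentiable f x.
Proof. by move/(_ [::] x). Qed.

Lemma smooth_pd i f : smooth f -> smooth (pd i f).
Proof. by move=> sf s x; rewrite iter_partial_pd; apply: sf. Qed.

Lemma smooth_iter_partial s f : smooth f -> smooth (iter_partial s f).
Proof. by move=> sf; elim: s => //= i s IH; exact: smooth_pd. Qed.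

Lemma pd_comp_linear (L : {linear V -> W}) i f : continuous L ->
  (forall x, differentiable f x) -> pd i (L \o f) = L \o pd i f.
Proof.
move=> cL df; apply/funext => x; rewrite /pd /=.
have dL y : differentiable L y by exact: linear_differentiable.
rewrite deriveE; last exact: differentiable_comp.
by rewrite diff_comp //= diff_lin // deriveE.
Qed.

Lemma iter_partial_comp_linear (L : {linear V -> W}) s f : continuous L ->
  smooth f -> iter_partial s (L \o f) = L \o iter_partial s f.
Proof.
move=> cL sf; elim: s => [//|i s IH].
by rewrite !iter_partial_cons IH pd_comp_linear.
Qed.

Lemma smooth_comp_linear (L : {linear V -> W}) f : continuous L ->
  smooth f -> smooth (L \o f).
Proof.
move=> cL sf s x; rewrite iter_partial_comp_linear //.
by apply: differentiable_comp => //; exact: linear_differentiable.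
Qed.

Lemma pdD i f g : (forall x, differentiable f x) ->
  (forall x, differentiable g x) ->
  pd i (fun x => f x + g x) = fun x => pd i f x + pd i g x.
Proof.
by move=> df dg; apply/funext => x; apply: deriveD; exact: diff_derivable.
Qed.

Lemma iter_partialD s f g : smooth f -> smooth g ->
  iter_partial s (fun x => f x + g x) =
  fun x => iter_partial s f x + iter_partial s g x.
Proof.
by move=> sf sg; elim: s => [//|i s IH]; rewrite !iter_partial_cons IH pdD.
Qed.

Lemma smoothD f g : smooth f -> smooth g -> smooth (fun x => f x + g x).
Proof. by move=> sf sg s x; rewrite iter_partialD //; exact: differentiableD. Qed.

Lemma pd_cst i (c : V) : pd i (fun=> c) = fun=> 0.
Proof. by apply/funext => x; rewrite /pd -[fun=> c]/(cst c) derive_cst. Qed.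

Lemma iter_partial0 s : iter_partial s (fun=> 0 : V) = fun=> 0.
Proof. by elim: s => [//|i s IH]; rewrite iter_partial_cons IH; exact: pd_cst. Qed.

Lemma smooth0 : smooth (fun _ : R8 => 0 : V).
Proof. by move=> s x; rewrite iter_partial0; exact: differentiable_cst. Qed.

Lemma pdZ i (c : R) f : (forall x, differentiable f x) ->
  pd i (fun x => c *: f x) = fun x => c *: pd i f x.
Proof.
by move=> df; apply/funext => x; apply: deriveZ; exact: diff_derivable.
Qed.

Lemma iter_partialZ s (c : R) f : smooth f ->
  iter_partial s (fun x => c *: f x) = fun x => c *: iter_partial s f x.
Proof. by move=> sf; elim: s => [//|i s IH]; rewrite !iter_partial_cons IH pdZ. Qed.

Lemma smoothZ (c : R) f : smooth f -> smooth (fun x => c *: f x).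
Proof. by move=> sf s x; rewrite iter_partialZ //; exact: differentiableZ. Qed.

Lemma smoothN f : smooth f -> smooth (fun x => - f x).
Proof.
by move=> sf; under eq_fun do rewrite -scaleN1r; exact: smoothZ.
Qed.

Lemma iter_partialN s f : smooth f ->
  iter_partial s (fun x => - f x) = fun x => - iter_partial s f x.
Proof.
move=> sf; under eq_fun do rewrite -scaleN1r; rewrite iter_partialZ //.
by apply/funext => x; rewrite scaleN1r.
Qed.

Lemma smoothB f g : smooth f -> smooth g -> smooth (fun x => f x - g x).
Proof. by move=> sf sg; apply: smoothD => //; exact: smoothN. Qed.

Lemma iter_partialB s f g : smooth f -> smooth g ->
  iter_partial s (fun x => f x - g x) =
  fun x => iter_partial s f x - iter_partial s g x.
Proof.
move=> sf sg; rewrite iter_partialD // ?iter_partialN //; exact: smoothN.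
Qed.

Section BigSum.
Variables (I : Type) (r : seq I) (P : pred I) (F : I -> R8 -> V).
Hypothesis smoothF : forall i, P i -> smooth (F i).

(** Both claims go through one induction on the list, since splitting off the head with
    [iter_partialD] already requires smoothness of the tail. *)
Lemma iter_partial_smooth_sum s :
  smooth (fun x => \sum_(i <- r | P i) F i x) /\
  iter_partial s (fun x => \sum_(i <- r | P i) F i x) =
  fun x => \sum_(i <- r | P i) iter_partial s (F i) x.
Proof.
elim: r => [|i r' [sr IH]].
  have nilE (G : I -> R8 -> V) :
      (fun x => \sum_(i <- [::] | P i) G i x) = fun=> 0.
    by apply/funext => x; rewrite big_nil.
  rewrite !nilE; split; [exact: smooth0 | exact: iter_partial0].
have -> : (fun x => \sum_(j <- i :: r' | P j) F j x) = fun x =>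
    (if P i then F i x + \sum_(j <- r' | P j) F j x
     else \sum_(j <- r' | P j) F j x).
  by apply/funext => x; rewrite big_cons.
have -> : (fun x => \sum_(j <- i :: r' | P j) iter_partial s (F j) x) = fun x =>
    (if P i then iter_partial s (F i) x + \sum_(j <- r' | P j) iter_partial s (F j) x
     else \sum_(j <- r' | P j) iter_partial s (F j) x).
  by apply/funext => x; rewrite big_cons.
case Pi: (P i) => //; split; first by apply: smoothD => //; exact: smoothF.
by rewrite iter_partialD ?IH //; exact: smoothF.
Qed.

Lemma smooth_sum : smooth (fun x => \sum_(i <- r | P i) F i x).
Proof. by have [] := iter_partial_smooth_sum [::]. Qed.

Lemma iter_partial_sum s : iter_partial s (fun x => \sum_(i <- r | P i) F i x) =
  fun x => \sum_(i <- r | P i) iter_partial s (F i) x.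
Proof. by have [] := iter_partial_smooth_sum s. Qed.

End BigSum.

Lemma pd_translate i (v : R8) f :
  pd i (fun x => f (x + v)) = fun x => pd i f (x + v).
Proof.
apply/funext => x; rewrite /pd /derive.
suff -> : (fun y => f (y + v)) \o shift x = f \o shift (x + v) by [].
by apply/funext => y /=; rewrite addrA.
Qed.

Lemma iter_partial_translate s (v : R8) f :
  iter_partial s (fun x => f (x + v)) = fun x => iter_partial s f (x + v).
Proof. by elim: s => [//|i s IH]; rewrite !iter_partial_cons IH pd_translate. Qed.

Lemma differentiable_translate (v : R8) f x :
  differentiable f (x + v) -> differentiable (fun y => f (y + v)) x.
Proof.
move=> df; rewrite -[fun y => _]/(f \o (fun y => y + v)).
exact: differentiable_comp.
Qed.

Lemma smooth_translate (v : R8) f : smooth f -> smooth (fun x => f (x + v)).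
Proof.
move=> sf s x; rewrite iter_partial_translate.
exact/differentiable_translate/sf.
Qed.

End Smooth.
End Calculus.

(** * Taylor estimates with uniform constants *)

Section Taylor.
Variable R : realType.
Notation R8 := 'rV[R]_8.
Local Notation e := (@e R).
Implicit Types (f : R8 -> R) (x v : R8) (C t : R).

(** The derivative is bounded only up to |t|, so a bound that itself depends on t can be fed in;
    this lets the Taylor estimates climb one order at a time. *)
Lemma mean_value_bound (phi dphi : R -> R) t C :
  (forall s, is_derive s (1 : R) phi (dphi s)) ->
  (forall s, `|s| <= `|t| -> `|dphi s| <= C) ->
  `|phi t - phi 0| <= C * `|t|.
Proof.
move=> dE dC.
have cphi a b : {within `[a, b], continuous phi}.
  apply: continuous_subspaceT => s.
  by apply: differentiable_continuous; apply/derivable1_diffP; case: (dE s).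
have [t0|t0] := leP 0 t.
  have [c cI ->] := MVT_segment t0 (fun s _ => dE s) (cphi _ _).
  rewrite subr0 normrM ler_wpM2r // dC // !ger0_norm //.
    by move: cI; rewrite in_itv => /andP[].
  by move: cI; rewrite in_itv => /andP[].
have [c cI E] := MVT_segment (ltW t0) (fun s _ => dE s) (cphi _ _).
rewrite distrC E sub0r normrM normrN ler_wpM2r // dC //.
move: cI; rewrite in_itv /= => /andP[tc c0].
by rewrite !ler0_norm ?(ltW t0) // lerN2.
Qed.

Lemma is_derive_line f x v t : differentiable f (x + t *: v) ->
  is_derive t (1 : R) (fun s => f (x + s *: v)) ('D_v f (x + t *: v)).
Proof.
move=> df.
have E : (fun h : R => h^-1 *: (((fun s : R => f (x + s *: v)) \o shift t) (h *: 1)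
                           - f (x + t *: v))) =
         (fun h : R => h^-1 *: ((f \o shift (x + t *: v)) (h *: v) - f (x + t *: v))).
  apply/funext => h /=; congr (_ *: (f _ - _)).
  by rewrite [h *: 1]mulr1 scalerDl addrCA.
apply: DeriveDef; last by rewrite /derive E.
by rewrite /derivable E; exact: diff_derivable.
Qed.

Lemma row_e_sum v : v = \sum_i v 0 i *: e i.
Proof. exact: row_sum_delta. Qed.

Lemma derive_sum_pd (V : normedModType R) (f : R8 -> V) x v : differentiable f x ->
  'D_v f x = \sum_i v 0 i *: pd i f x.
Proof.
move=> df; rewrite deriveE // {1}(row_e_sum v) linear_sum.
by apply: eq_bigr => i _; rewrite linearZ /pd deriveE.
Qed.

Lemma sum8_const (c : R) : \sum_(i < 8) c = 8%:R * c.
Proof. by rewrite sumr_const card_ord mulr_natl. Qed.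

Lemma coord_le_norm v i : `|v 0 i| <= `|v|.
Proof.
rewrite [leRHS]/Num.Def.normr /= mx_normrE.
exact: (le_bigmax _ (fun ij : 'I_1 * 'I_8 => `|v ij.1 ij.2|) (0, i)).
Qed.

(** The norm on rows is the sup norm, so each of the eight coordinates of v contributes at most C
    |v|. *)
Lemma lipschitz_bound f x v C : smooth f -> (forall i y, `|pd i f y| <= C) ->
  `|f (x + v) - f x| <= 8%:R * C * `|v|.
Proof.
move=> sf fC.
have C0 : 0 <= C := le_trans (normr_ge0 _) (fC ord0 x).
have := @mean_value_bound (fun s => f (x + s *: v)) (fun s => 'D_v f (x + s *: v)) 1
  (8%:R * C * `|v|).
rewrite scale1r scale0r addr0 normr1 mulr1; apply.
  by move=> s; apply/is_derive_line/smooth_differentiable.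
move=> s _; rewrite derive_sum_pd; last exact: smooth_differentiable.
rewrite -mulrA -sum8_const.
apply: le_trans (ler_norm_sum _ _ _) _; apply: ler_sum => i _.
by rewrite normrM mulrC ler_pM // coord_le_norm.
Qed.

(** Along the segment, f minus its linear part has a derivative controlled by the Lipschitz bound
    for the first derivatives, whence 64 = 8 * 8. The constant sees second derivatives only, so the
    estimate survives pointwise limits. *)
Lemma quadratic_bound f x v C : smooth f ->
  (forall i j y, `|pd i (pd j f) y| <= C) ->
  `|f (x + v) - f x - \sum_i v 0 i *: pd i f x| <= 64%:R * C * `|v| ^+ 2.
Proof.
move=> sf fC; set S := \sum_i _.
have C0 : 0 <= C := le_trans (normr_ge0 _) (fC ord0 ord0 x).
have dl s : is_derive s (1 : R) (fun s => f (x + s *: v) - s * S)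
    ('D_v f (x + s *: v) - S).
  have := is_derive_line (smooth_differentiable (x + s *: v) sf).
  by move=> ?; apply: is_derive_eq; rewrite scaler0 add0r [_%:A]mulr1.
have := @mean_value_bound _ _ 1 (64%:R * C * `|v| ^+ 2) dl.
rewrite scale1r mul1r scale0r addr0 mul0r subr0 normr1 mulr1.
have -> : f (x + v) - S - f x = f (x + v) - f x - S by rewrite addrAC.
apply=> s s1; rewrite derive_sum_pd; last exact: smooth_differentiable.
rewrite /S -sumrB.
have -> : 64%:R * C * `|v| ^+ 2 = (8%:R * (`|v| * (8%:R * C * `|v|))) by ring.
rewrite -(sum8_const (`|v| * _)).
apply: le_trans (ler_norm_sum _ _ _) _; apply: ler_sum => i _.
rewrite -scalerBr normrM ler_pM ?coord_le_norm //.
apply: le_trans (lipschitz_bound _ _ _ _) _; [exact: smooth_pd|by move=> j y; exact: fC|].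
rewrite ler_wpM2l // ?mulr_ge0 //.
by rewrite normrZ ler_piMl.
Qed.

Lemma taylor0 f i x t C : smooth f -> (forall y, `|pd i f y| <= C) ->
  `|f (x + t *: e i) - f x| <= C * `|t|.
Proof.
move=> sf fC.
have := @mean_value_bound (fun s => f (x + s *: e i)) (fun s => pd i f (x + s *: e i)) t C.
rewrite scale0r addr0; apply => // s.
by apply/is_derive_line/smooth_differentiable.
Qed.

(** Subtracting the Taylor polynomial leaves a function whose derivative is the remainder of one
    order less for [pd i f]. The factorials are given up; only the power of t matters. *)
Lemma taylor1 f i x t C : smooth f -> (forall y, `|pd i (pd i f) y| <= C) ->
  `|f (x + t *: e i) - f x - t * pd i f x| <= C * `|t| ^+ 2.
Proof.
move=> sf fC; set S := pd i f x.
have C0 : 0 <= C := le_trans (normr_ge0 _) (fC x).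
have dl s : is_derive s (1 : R) (fun s => f (x + s *: e i) - s * S)
    (pd i f (x + s *: e i) - S).
  have := is_derive_line (smooth_differentiable (x + s *: e i) sf).
  by move=> ?; apply: is_derive_eq; rewrite scaler0 add0r [_%:A]mulr1.
have := @mean_value_bound _ _ t (C * `|t|) dl.
rewrite scale0r addr0 mul0r subr0 -mulrA -expr2.
have -> : f (x + t *: e i) - t * S - f x = f (x + t *: e i) - f x - t * S.
  by rewrite addrAC.
apply=> s st.
apply: le_trans (taylor0 _ _ (smooth_pd i sf) fC) _.
by rewrite ler_wpM2l.
Qed.

Lemma taylor2 f i x t C : smooth f -> (forall y, `|pd i (pd i (pd i f)) y| <= C) ->
  `|f (x + t *: e i) - f x - t * pd i f x - t ^+ 2 / 2 * pd i (pd i f) x|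
    <= C * `|t| ^+ 3.
Proof.
move=> sf fC; set S := pd i f x; set S2 := pd i (pd i f) x.
have C0 : 0 <= C := le_trans (normr_ge0 _) (fC x).
have dl s : is_derive s (1 : R) (fun s => f (x + s *: e i) - s * S - s ^+ 2 * (S2 / 2))
    (pd i f (x + s *: e i) - S - s * S2).
  have := is_derive_line (smooth_differentiable (x + s *: e i) sf).
  move=> ?; apply: is_derive_eq; rewrite /pd !scaler0 !add0r.
  rewrite [S%:A]mulr1 [s%:A]mulr1; congr (_ - _ - _).
  by rewrite -[LHS]/(S2 / 2 * (s + s)); field.
have := @mean_value_bound _ _ t (C * `|t| ^+ 2) dl.
rewrite scale0r addr0 expr0n /= !mul0r !subr0 -mulrA -exprSr.
have -> : f (x + t *: e i) - t * S - t ^+ 2 * (S2 / 2) - f x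
  = f (x + t *: e i) - f x - t * S - t ^+ 2 / 2 * S2 by field.
apply=> s st.
apply: le_trans (taylor1 _ _ (smooth_pd i sf) fC) _.
by rewrite ler_wpM2l // lerXn2r // nnegrE.
Qed.

(** The first-order terms at t and -t cancel, leaving an error of third order. *)
Lemma central_difference f i x t C : smooth f ->
  (forall y, `|pd i (pd i (pd i f)) y| <= C) ->
  `|f (x + t *: e i) + f (x - t *: e i) - 2 * f x - t ^+ 2 * pd i (pd i f) x|
    <= 2 * C * `|t| ^+ 3.
Proof.
move=> sf fC.
have := taylor2 x t sf fC; have := taylor2 x (- t) sf fC.
rewrite scaleNr normrN; set P := (X in `|X|) => P1; set Q := (X in `|X|) => Q1.
set T := (X in `|X| <= _).
have -> : T = P + Q by rewrite /T /P /Q; field.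
by rewrite (le_trans (ler_normD _ _)) // -mulrA mulr_natl mulr2n lerD.
Qed.

End Taylor.

(** * The discrete maximum principle *)

Section Periodic.
Variable R : realType.
Notation R8 := 'rV[R]_8.
Local Notation e := (@e R).
Implicit Types (f : R8 -> R) (x v : R8).

Definition periodic2 (V : Type) (f : R8 -> V) :=
  forall i x, f (x + 2%:R *: e i) = f x.

Definition antiperiodic (k : 'I_8) f := forall x, f (x + e k) = - f x.

Lemma periodic2_int f i (n : int) x : periodic2 f ->
  f (x + (2%:R * n%:~R) *: e i) = f x.
Proof.
move=> pf.
have pn (m : nat) y : f (y + (2%:R * m%:R) *: e i) = f y.
  elim: m y => [|m IH] y; first by rewrite mulr0 scale0r addr0.
  by rewrite -[m.+1]addn1 natrD mulrDr mulr1 scalerDl addrA pf IH.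
case: n => m; first exact: pn.
by rewrite NegzE mulrNz mulrN scaleNr -[RHS](pn m.+1) -[LHS](pn m.+1) subrK pn.
Qed.

Lemma periodic2_reduce f x : periodic2 f ->
  exists2 y : R8, (forall i, 0 <= y 0 i <= 2) & f y = f x.
Proof.
move=> pf; pose n i := - Num.floor (x 0 i / 2).
have pr (r : seq 'I_8) y : f (y + \sum_(i <- r) (2%:R * (n i)%:~R) *: e i) = f y.
  elim: r y => [|i r IH] y; first by rewrite big_nil addr0.
  by rewrite big_cons addrA IH periodic2_int.
exists (x + \sum_i (2%:R * (n i)%:~R) *: e i); last exact: pr.
move=> i.
have -> : \sum_i (2%:R * (n i)%:~R) *: e i = \row_i (2%:R * (n i)%:~R).
  by rewrite [RHS]row_e_sum; apply: eq_bigr => j _; rewrite mxE.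
rewrite !mxE /n mulrNz.
have := floor_itv (x 0 i / 2).
by rewrite intrD; lra.
Qed.

Lemma periodic2_bounded f : continuous f -> periodic2 f ->
  exists C, forall x, `|f x| <= C.
Proof.
move=> cf pf.
have : compact [set v : R8 | forall i, `[0 : R, 2]%classic (v ord0 i)].
  by apply: (@rV_compact _ _ (fun=> `[0 : R, 2]%classic)) => _; exact: segment_compact.
move=> /(@EVT_max_rV R 8 (fun x => `|f x|)) H.
have [||c _ fc] := H.
- by exists 0 => i /=; rewrite mxE in_itv /= lexx ler0n.
- apply: continuous_subspaceT => x; apply: continuous_comp; first exact: cf.
  exact: norm_continuous.
exists `|f c| => x; have [y yI <-] := periodic2_reduce x pf.
by apply: fc; rewrite inE /= => i; rewrite in_itv /=; exact: yI.
Qed.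

Definition neighbour_sum (h : R) f x :=
  \sum_i (f (x + h *: e i) + f (x - h *: e i)).

(** The usual difference Laplacian multiplied by h^2; 16 counts the neighbours of a point. *)
Definition discrete_laplacian (h : R) f x := neighbour_sum h f x - 16%:R * f x.

(** Convexity puts c t below the chord from 0 to t + 1, which is [up]; starting at n, nonpositivity
    is then carried down one index at a time. *)
Lemma discrete_convex (c : nat -> R) n : c 0%N <= 0 -> c n <= 0 ->
  (forall t, (0 < t < n)%N -> 2 * c t <= c t.-1 + c t.+1) ->
  forall t, (t <= n)%N -> c t <= 0.
Proof.
move=> c0 cn cvx.
have up t : (t < n)%N -> t.+1%:R * c t <= t%:R * c t.+1 + c 0%N.
  elim: t => [|t IH] tn; first by rewrite mul1r mul0r add0r.
  have {}IH := IH (ltnW tn).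
  have := cvx t.+1; rewrite tn /= => /(_ isT) ct.
  have : t.+1%:R * (2 * c t.+1) <= t.+1%:R * (c t + c t.+2) by rewrite ler_wpM2l.
  move: IH; rewrite -[t.+2%:R]natr1 -![t.+1%:R]natr1.
  by move: (t%:R : R) (c t) (c t.+1) (c t.+2) => a x y z; lra.
move=> t tn; rewrite -(subKn tn); elim: (n - t)%N (leq_subr t n) => [|d IH] dn.
  by rewrite subn0.
have := up (n - d.+1)%N; rewrite ltn_subrL (leq_trans _ dn) // => /(_ isT).
rewrite subnSK // => H; have {}IH := IH (ltnW dn).
rewrite -(@pmulr_rle0 _ (n - d)%:R) ?ltr0n ?subn_gt0 //.
apply: le_trans H _; apply: le_trans c0; rewrite gerDr.
by rewrite mulr_ge0_le0.
Qed.

(* Reflection coupling: f(x + t e_k) - f(x - t e_k) vanishes at t = 0 and at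
   t = 1, and its second difference in (t, x) is controlled by the discrete
   Laplacian of f, so it is dominated by the parabola G t (1 - t). *)
Lemma discrete_maximum_principle k m f B G : (0 < m)%N ->
  let h := (2 * m%:R)^-1 in
  (forall x, `|f x| <= B) -> antiperiodic k f ->
  (forall x, `|discrete_laplacian h f x| <= G * h ^+ 2) ->
  forall x, `|f x| <= G / 8.
Proof.
move=> m0 h fB af fG.
have mR0 : (0 : R) < m%:R by rewrite ltr0n.
pose phi (t : nat) x := f (x + (t%:R * h) *: e k) - f (x - (t%:R * h) *: e k).
pose M t := sup (range (phi t)).
have leM t x : phi t x <= M t.
  apply: ub_le_sup; last by exists x.
  exists (B + B) => _ [y _ <-]; rewrite /phi.
  by apply: lerD; [|rewrite lerNl]; move: (fB (y + (t%:R * h) *: e k))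
     (fB (y - (t%:R * h) *: e k)); rewrite !ler_norml => /andP[? ?] /andP[].
have Mle t c : (forall x, phi t x <= c) -> M t <= c.
  by move=> phic; apply: ge_sup; [exists (phi t 0), 0|move=> _ [x _ <-]].
have afN x : f (x - e k) = - f x by rewrite -[in RHS](subrK (e k) x) af opprK.
have M0 : M 0%N <= 0.
  by apply: Mle => x; rewrite /phi mul0r scale0r addr0 subr0 subrr.
(* At t = 2m the displacement is a full unit and both points carry the value - f x. *)
have M2m : M (2 * m)%N <= 0.
  apply: Mle => x; rewrite /phi natrM divff ?mulf_neq0 ?gt_eqF // scale1r.
  by rewrite af afN subrr.
have conv t : (0 < t)%N -> 2 * M t <= M t.-1 + M t.+1 + 2 * G * h ^+ 2.
  move=> t0.
  suff : M t <= (14%:R * M t + M t.-1 + M t.+1 + 2 * G * h ^+ 2) / 16%:R by lra.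
  apply: Mle => x.
  set th := (t%:R * h) *: e k.
  (* Neighbours of the two points are paired by reflection in direction k, which changes t by one,
     and by translation in the other seven directions, which moves x and keeps t. The latter give 14
     terms, each at most [M t]. *)
  have E : discrete_laplacian h f (x + th) - discrete_laplacian h f (x - th) =
     (phi t.+1 x + phi t.-1 x) +
     \sum_(i | i != k) (phi t (x + h *: e i) + phi t (x - h *: e i))
     - 16%:R * phi t x.
    have hE (s : nat) : ((s.+1)%:R * h) *: e k = (s%:R * h) *: e k + h *: e k.
      by rewrite -[s.+1]addn1 natrD mulrDl mul1r scalerDl.
    rewrite /discrete_laplacian /neighbour_sum.
    have rearrange (a b c d : R) :
      a - 16%:R * b - (c - 16%:R * d) = a - c - 16%:R * (b - d) by ring.
    rewrite rearrange -sumrB (bigD1 k) //=; congr (_ + _ - _).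
      rewrite /phi hE -/th -[in t.-1%:R](prednK t0) /=.
      have -> : (t.-1%:R * h) *: e k = th - h *: e k.
        by rewrite /th -[in RHS](prednK t0) hE addrK.
      rewrite !opprD !opprK !addrA; ring.
    apply: eq_bigr => i _; rewrite /phi -/th.
    by rewrite ![x + _ *: e i + _]addrAC ![x - _ *: e i + _]addrAC; ring.
  have S : \sum_(i | i != k) (phi t (x + h *: e i) + phi t (x - h *: e i))
       <= 14%:R * M t.
    apply: le_trans (_ : \sum_(i | i != k) (M t + M t) <= _).
      by apply: ler_sum => i _; apply: lerD.
    by rewrite sumr_const cardC1 card_ord -mulr2n -mulrnA mulr_natl.
  have := fG (x + th); have := fG (x - th); rewrite !ler_norml.
  move=> /andP[_ ?] /andP[? _].
  by have := leM t.+1 x; have := leM t.-1 x; lra.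
(* The parabola G h^2 t (2m - t) has second difference - 2 G h^2 and vanishes at both ends; at t = m
   it equals G / 4 because h = 1 / (2m). *)
have half : M m <= G / 4.
  have := @discrete_convex (fun t => M t - G * h ^+ 2 * (t%:R * ((2 * m)%:R - t%:R)))
    (2 * m) _ _ _ m.
  rewrite mul0r mulr0 subr0 subrr !mulr0 subr0 => /(_ M0 M2m).
  have -> : G * h ^+ 2 * (m%:R * ((2 * m)%:R - m%:R)) = G / 4.
    by rewrite natrM /h; field; rewrite gt_eqF.
  rewrite subr_le0; apply; last by rewrite mul2n -addnn leq_addr.
  move=> t /andP[t0 _]; have := conv t t0.
  have -> : t%:R = t.-1%:R + 1 :> R by rewrite natr1 prednK.
  rewrite -[t.+1%:R]natr1; have -> : t%:R = t.-1%:R + 1 :> R by rewrite natr1 prednK.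
  move: (t.-1%:R : R) ((2 * m)%:R : R) (M t) (M t.+1) (M t.-1) => a b x y z.
  by lra.
have fle x : f x <= G / 8.
  (* Centred half a unit behind x, the two mirror points are x and x - e_k, so the difference is 2 f
     x by antiperiodicity. *)
  have := le_trans (leM m (x - 2^-1 *: e k)) half.
  have hm : m%:R * h = 2^-1 by rewrite /h; field; rewrite gt_eqF.
  rewrite /phi hm subrK -addrA -opprD -scalerDl.
  have -> : 2^-1 + 2^-1 = 1 :> R by field.
  by rewrite scale1r afN; lra.
by move=> x; rewrite ler_norml fle andbT lerNl -af fle.
Qed.

Definition laplacian (V : normedModType R) (f : R8 -> V) x :=
  \sum_i pd i (pd i f) x.

Lemma laplacianB (V : normedModType R) (f g : R8 -> V) x :
  smooth f -> smooth g ->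
  laplacian (fun x => f x - g x) x = laplacian f x - laplacian g x.
Proof.
move=> sf sg; rewrite /laplacian -sumrB; apply: eq_bigr => i _.
by rewrite -[LHS]/(iter_partial [:: i; i] _ x) iter_partialB.
Qed.

Lemma discrete_laplacian_approx f h x C : smooth f -> 0 <= h ->
  (forall i y, `|pd i (pd i (pd i f)) y| <= C) ->
  `|discrete_laplacian h f x - h ^+ 2 * laplacian f x| <= 16%:R * C * h ^+ 3.
Proof.
move=> sf h0 fC.
have -> : discrete_laplacian h f x - h ^+ 2 * laplacian f x =
    \sum_i (f (x + h *: e i) + f (x - h *: e i) - 2 * f x
            - h ^+ 2 * pd i (pd i f) x).
  rewrite !sumrB sum8_const /discrete_laplacian mulrA -natrM.
  by rewrite /laplacian mulr_sumr.
have -> : 16%:R * C * h ^+ 3 = \sum_(i < 8) (2 * C * `|h| ^+ 3).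
  by rewrite sum8_const ger0_norm //; ring.
apply: le_trans (ler_norm_sum _ _ _) _; apply: ler_sum => i _.
exact: central_difference.
Qed.

Lemma archimedean_inv (C eps : R) : 0 < eps ->
  exists2 m : nat, (0 < m)%N & C / m%:R <= eps.
Proof.
move=> eps0; exists (Num.bound (C / eps)).+1 => //.
rewrite ler_pdivrMr ?ltr0n // mulrC -ler_pdivrMr //.
have [C0|C0] := leP 0 (C / eps); last by apply: le_trans (ltW C0) _.
by apply: le_trans (ltW (archi_boundP C0)) _; rewrite ler_nat.
Qed.

Definition antiperiodic_class k f :=
  [/\ smooth f, periodic2 f & antiperiodic k f].

Lemma smooth_continuous (V : normedModType R) (f : R8 -> V) :
  smooth f -> continuous f.
Proof. by move=> sf x; exact/differentiable_continuous/smooth_differentiable. Qed.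

Lemma periodic2_pd (V : normedModType R) i (f : R8 -> V) :
  periodic2 f -> periodic2 (pd i f).
Proof.
move=> pf j x; rewrite -[LHS]/((fun y => pd i f (y + _)) x) -pd_translate.
by congr (pd i _ x); apply/funext => y; exact: pf.
Qed.

Lemma antiperiodic_class_pd k i f :
  antiperiodic_class k f -> antiperiodic_class k (pd i f).
Proof.
move=> [sf pf af]; split; [exact: smooth_pd | exact: periodic2_pd |].
move=> x; rewrite -[LHS]/((fun y => pd i f (y + _)) x) -pd_translate.
have -> : (fun y => f (y + e k)) = fun y => - f y by apply/funext.
by rewrite -[pd i]/(iter_partial [:: i]) iter_partialN.
Qed.

Lemma antiperiodic_class_iter k s f :
  antiperiodic_class k f -> antiperiodic_class k (iter_partial s f).
Proof. by move=> cf; elim: s => //= i s; exact: antiperiodic_class_pd. Qed.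

Lemma antiperiodic_classB k f g : antiperiodic_class k f ->
  antiperiodic_class k g -> antiperiodic_class k (fun x => f x - g x).
Proof.
move=> [sf pf af] [sg pg ag]; split; first exact: smoothB.
  by move=> i x; rewrite pf pg.
by move=> x; rewrite af ag opprB opprK addrC.
Qed.

Lemma antiperiodic_class_bounded k f : antiperiodic_class k f ->
  exists C, forall x, `|f x| <= C.
Proof. by move=> [/smooth_continuous cf pf _]; exact: periodic2_bounded. Qed.

Lemma laplacian_bound k f G : antiperiodic_class k f ->
  (forall x, `|laplacian f x| <= G) -> forall x, `|f x| <= G / 8.
Proof.
move=> cf fG x; have [sf _ af] := cf.
have [B fB] := antiperiodic_class_bounded cf.
have /choice [C fC] : forall i, exists C, forall y, `|pd i (pd i (pd i f)) y| <= C.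
  by move=> i; apply: (@antiperiodic_class_bounded k); do 3 apply: antiperiodic_class_pd.
pose K := \sum_i C i.
have C0 i : 0 <= C i := le_trans (normr_ge0 _) (fC i 0).
have fK i y : `|pd i (pd i (pd i f)) y| <= K.
  by apply: le_trans (fC i y) _; rewrite /K (bigD1 i) //= lerDl sumr_ge0.
apply/ler_addgt0Pr => eps eps0.
have [m m0 mK] := archimedean_inv K eps0.
have mR : (0 : R) < m%:R by rewrite ltr0n.
pose h : R := (2 * m%:R)^-1; have h0 : 0 <= h by rewrite invr_ge0 mulr_ge0.
(* The consistency error 16 K h, divided by 8, is K / m for h = 1 / (2m), hence below eps. *)
have := @discrete_maximum_principle k m f B (G + 16%:R * K * h) m0 fB af.
move=> /(_ _ x) H; apply: le_trans (H _) _.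
  move=> y; have := discrete_laplacian_approx y sf h0 fK.
  set D := discrete_laplacian _ _ _ => DE.
  rewrite -[D](subrK (h ^+ 2 * laplacian f y)).
  apply: le_trans (ler_normD _ _) _.
  rewrite normrM (ger0_norm (exprn_ge0 _ h0)).
  have := ler_wpM2l (exprn_ge0 2 h0) (fG y); rewrite -/h.
  have -> : (G + 16%:R * K * h) * h ^+ 2 = h ^+ 2 * G + 16%:R * K * h ^+ 3 by ring.
  by move=> ?; rewrite addrC lerD.
rewrite mulrDl lerD2l; apply: le_trans mK.
by rewrite /h (_ : _ / 8 = K / m%:R) //; field; rewrite gt_eqF.
Qed.

Lemma laplacian_eq0 k f : antiperiodic_class k f ->
  (forall x, laplacian f x = 0) -> forall x, f x = 0.
Proof.
move=> cf f0 x; apply/eqP; rewrite -normr_le0 -[leRHS](mul0r (8^-1)).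
by apply: (laplacian_bound cf) => y; rewrite f0 normr0.
Qed.

End Periodic.

(** * Solving the Poisson equation *)

Section Jacobi.
Variable R : realType.
Notation R8 := 'rV[R]_8.
Local Notation e := (@e R).
Implicit Types (f u : R8 -> R) (x v : R8).

Lemma smooth_neighbour_sum (h : R) f : smooth f -> smooth (neighbour_sum h f).
Proof.
move=> sf; apply: smooth_sum => i _.
by apply: smoothD; exact: smooth_translate.
Qed.

Lemma iter_partial_neighbour_sum s (h : R) f : smooth f ->
  iter_partial s (neighbour_sum h f) = neighbour_sum h (iter_partial s f).
Proof.
move=> sf; rewrite /neighbour_sum iter_partial_sum; last first.
  by move=> i _; apply: smoothD; exact: smooth_translate.
apply/funext => x; apply: eq_bigr => i _.
by rewrite iter_partialD ?iter_partial_translate //; exact: smooth_translate.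
Qed.

Lemma neighbour_sum_antiperiodic k h f : antiperiodic k f ->
  antiperiodic k (neighbour_sum h f).
Proof.
move=> af x; rewrite /neighbour_sum -sumrN; apply: eq_bigr => i _.
by rewrite ![x + e k + _]addrAC !af opprD.
Qed.

Lemma neighbour_sum_periodic2 h f : periodic2 f -> periodic2 (neighbour_sum h f).
Proof.
move=> pf j x; apply: eq_bigr => i _.
by rewrite ![x + _ *: e j + _]addrAC !pf.
Qed.

Lemma neighbour_sum_bound h f B : (forall x, `|f x| <= B) ->
  forall x, `|neighbour_sum h f x| <= 16%:R * B.
Proof.
move=> fB x; apply: le_trans (ler_norm_sum _ _ _) _.
have -> : 16%:R * B = \sum_(i < 8) (B + B) by rewrite sum8_const; ring.
by apply: ler_sum => i _; apply: le_trans (ler_normD _ _) _; apply: lerD.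
Qed.

(* Jacobi iteration for (eps - Delta_h) u = f, where q = 1 / (16 + eps h^2). *)
Definition jacobi_step (q h : R) f u : R8 -> R :=
  fun x => q *: (neighbour_sum h u x + h ^+ 2 *: f x).

Definition jacobi (q h : R) f n : R8 -> R := iter n (jacobi_step q h f) (fun=> 0).

Lemma smooth_jacobi_step q h f u :
  smooth f -> smooth u -> smooth (jacobi_step q h f u).
Proof.
move=> sf su; apply: smoothZ; apply: smoothD; first exact: smooth_neighbour_sum.
exact: smoothZ.
Qed.

Lemma iter_partial_jacobi_step s q h f u : smooth f -> smooth u ->
  iter_partial s (jacobi_step q h f u) =
  jacobi_step q h (iter_partial s f) (iter_partial s u).
Proof.
move=> sf su; have sn := smooth_neighbour_sum h su.
rewrite /jacobi_step iter_partialZ; last by apply: smoothD => //; exact: smoothZ.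
rewrite iter_partialD //; last exact: smoothZ.
by rewrite iter_partialZ // iter_partial_neighbour_sum.
Qed.

Lemma smooth_jacobi q h f n : smooth f -> smooth (jacobi q h f n).
Proof.
by move=> sf; elim: n => [|n IH]; [exact: smooth0 | exact: smooth_jacobi_step].
Qed.

(** The scheme is linear, starts at 0 and commutes with translations, so derivatives of an iterate
    are iterates for the differentiated right-hand side. Every sup bound for [jacobi] thereby bounds
    all derivatives. *)
Lemma iter_partial_jacobi s q h f n : smooth f ->
  iter_partial s (jacobi q h f n) = jacobi q h (iter_partial s f) n.
Proof.
move=> sf; elim: n => [|n IH]; first exact: iter_partial0.
by rewrite [LHS]iter_partial_jacobi_step // ?IH //; exact: smooth_jacobi.
Qed.

Lemma antiperiodic_jacobi k q h f n : antiperiodic k f ->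
  antiperiodic k (jacobi q h f n).
Proof.
move=> af; elim: n => [|n IH] x; first by rewrite oppr0.
rewrite /jacobi iterS -/(jacobi q h f n) /jacobi_step.
by rewrite neighbour_sum_antiperiodic // af scalerN -opprD scalerN.
Qed.

Lemma periodic2_jacobi q h f n : periodic2 f -> periodic2 (jacobi q h f n).
Proof.
move=> pf; elim: n => [//|n IH] i x.
rewrite /jacobi iterS -/(jacobi q h f n) /jacobi_step.
by rewrite neighbour_sum_periodic2 // pf.
Qed.

Lemma antiperiodic_class_jacobi k q h f n : antiperiodic_class k f ->
  antiperiodic_class k (jacobi q h f n).
Proof.
move=> [sf pf af]; split; [exact: smooth_jacobi | exact: periodic2_jacobi |].
exact: antiperiodic_jacobi.
Qed.

(** B / eps is the fixed point of the scalar majorant: q (16 B / eps + h^2 B) = B / eps. *)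
Lemma jacobi_bound (h eps B : R) f n : 0 < eps ->
  let q := (16%:R + eps * h ^+ 2)^-1 in
  (forall x, `|f x| <= B) -> forall x, `|jacobi q h f n x| <= B / eps.
Proof.
move=> eps0 q fB; have B0 : 0 <= B := le_trans (normr_ge0 _) (fB 0).
have d0 : 0 < 16%:R + eps * h ^+ 2.
  by rewrite ltr_pwDl // mulr_ge0 ?sqr_ge0 // ltW.
elim: n => [|n IH] x; first by rewrite normr0 divr_ge0 // ltW.
rewrite /jacobi iterS -/(jacobi q h f n) /jacobi_step normrZ.
rewrite (gtr0_norm (_ : 0 < q)) ?invr_gt0 // mulrC ler_pdivrMr //.
apply: le_trans (ler_normD _ _) _; rewrite normrZ (ger0_norm (sqr_ge0 h)).
have := neighbour_sum_bound h IH x; have := ler_wpM2l (sqr_ge0 h) (fB x).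
have -> : B / eps * (16%:R + eps * h ^+ 2) = 16%:R * (B / eps) + h ^+ 2 * B.
  by field; rewrite gt_eqF.
by move=> ? ?; apply: lerD.
Qed.

(** Each step multiplies sup distances by at most 16 q, and q^-1 times the last increment is the
    residual of the regularised equation. Dropping the regularisation costs eps h^2 u, whence the
    term eps K. *)
Lemma jacobi_residual (h eps B K : R) f n : 0 < eps ->
  let q := (16%:R + eps * h ^+ 2)^-1 in
  (forall x, `|f x| <= B) -> (forall x, `|jacobi q h f n x| <= K) -> forall x,
  `|discrete_laplacian h (jacobi q h f n) x + h ^+ 2 * f x|
     <= h ^+ 2 * (eps * K + (16%:R * q) ^+ n * B).
Proof.
move=> eps0 q fB uK x.
have d0 : 0 < 16%:R + eps * h ^+ 2.
  by rewrite ltr_pwDl // mulr_ge0 ?sqr_ge0 // ltW.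
have q0 : 0 < q by rewrite invr_gt0.
have inc j : forall y, `|jacobi q h f j.+1 y - jacobi q h f j y|
    <= (16%:R * q) ^+ j * (q * (h ^+ 2 * B)).
  elim: j => [|j IH] y.
    rewrite /jacobi /= /jacobi_step subr0 /neighbour_sum big1 ?add0r //.
    rewrite mul1r normrZ normrZ (gtr0_norm q0) (ger0_norm (sqr_ge0 h)).
    by rewrite ler_wpM2l ?(ltW q0) // ler_wpM2l ?sqr_ge0.
  have -> : jacobi q h f j.+2 y - jacobi q h f j.+1 y =
     q * neighbour_sum h (fun x => jacobi q h f j.+1 x - jacobi q h f j x) y.
    rewrite /jacobi !(iterS j.+1) -!/(jacobi q h f j.+1).
    rewrite [X in _ - X](_ : _ = jacobi_step q h f (jacobi q h f j) y) //.
    rewrite /jacobi_step -scalerBr; congr (_ * _).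
    rewrite opprD addrACA subrr addr0 -sumrB; apply: eq_bigr => i _.
    by rewrite opprD addrACA.
  rewrite normrM (gtr0_norm q0) exprS.
  have -> : 16%:R * q * (16%:R * q) ^+ j * (q * (h ^+ 2 * B)) =
    q * (16%:R * ((16%:R * q) ^+ j * (q * (h ^+ 2 * B)))) by ring.
  by rewrite ler_wpM2l ?(ltW q0) //; exact: neighbour_sum_bound.
have -> : discrete_laplacian h (jacobi q h f n) x + h ^+ 2 * f x =
   eps * h ^+ 2 * jacobi q h f n x
   + q^-1 * (jacobi q h f n.+1 x - jacobi q h f n x).
  rewrite /jacobi iterS -/(jacobi q h f n) /jacobi_step.
  rewrite -[_ *: (_ + _)]/(q * (_ + h ^+ 2 * f x)) mulrBr mulKf ?gt_eqF //.
  by rewrite /discrete_laplacian /q invrK; ring.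
apply: le_trans (ler_normD _ _) _; rewrite [leRHS]mulrDr; apply: lerD.
  rewrite normrM (ger0_norm (mulr_ge0 (ltW eps0) (sqr_ge0 h))) mulrAC mulrC.
  by rewrite ler_wpM2l ?sqr_ge0 // ler_wpM2l // ltW.
rewrite normrM (gtr0_norm (_ : 0 < q^-1)) ?invr_gt0 // mulrC ler_pdivrMr //.
by apply: le_trans (inc n x) _; rewrite le_eqVlt; apply/orP; left; apply/eqP; ring.
Qed.

Lemma geometric_small (z eps : R) : 0 <= z < 1 -> 0 < eps -> exists n, z ^+ n <= eps.
Proof.
move=> /andP[z0 z1] eps0.
have := @cvg_expr R z; rewrite ger0_norm // => /(_ z1).
move/cvgrPdist_le => /(_ _ eps0) [n _ /(_ n (leqnn n))] /=.
by rewrite sub0r normrN ger0_norm ?exprn_ge0 // => H; exists n.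
Qed.

(** The iteration inverts eps - Delta_h, so u m approximates a solution of - Delta u = f, hence the
    plus sign. The order of quantifiers is the point: mesh, regularisation and number of iterations
    are fixed before s, B and C. *)
Lemma poisson_approx k f : antiperiodic_class k f -> exists u : nat -> R8 -> R,
  forall m, antiperiodic_class k (u m) /\
  forall s B C, (forall x, `|iter_partial s f x| <= B) ->
    (forall i x, `|pd i (pd i (pd i (iter_partial s f))) x| <= C) ->
    forall x, `|laplacian (iter_partial s (u m)) x + iter_partial s f x|
      <= (2 * B + 16%:R * C) / m.+1%:R.
Proof.
move=> cf; suff /choice[u uP] : forall m : nat, exists v : R8 -> R, antiperiodic_class k v /\
  forall s B C, (forall x, `|iter_partial s f x| <= B) ->
    (forall i x, `|pd i (pd i (pd i (iter_partial s f))) x| <= C) ->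
    forall x, `|laplacian (iter_partial s v) x + iter_partial s f x|
      <= (2 * B + 16%:R * C) / m.+1%:R by exists u.
move=> m; set M : R := m.+1%:R; have M0 : 0 < M by rewrite ltr0n.
have M1 : 1 <= M by rewrite ler1n.
pose h : R := (2 * m.+1%:R)^-1; have h0 : 0 < h by rewrite invr_gt0 mulr_gt0.
pose q := (16%:R + M^-1 * h ^+ 2)^-1.
have d0 : 0 < M^-1 * h ^+ 2 by rewrite mulr_gt0 ?invr_gt0 // exprn_gt0.
have [n nM] : exists n, (16%:R * q) ^+ n <= M^-1.
  apply: geometric_small; last by rewrite invr_gt0.
  rewrite /q ltr_pdivrMr ?mul1r ?ltrDl ?d0; last by rewrite ltr_pwDl // ltW.
  by rewrite andbT mulr_ge0 // invr_ge0 addr_ge0 // ltW.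
exists (jacobi q h f n); split; first exact: antiperiodic_class_jacobi.
move=> s B C fB fC x; have [sf _ _] := cf.
have [_ _ afs] := antiperiodic_class_iter s cf.
have B0 : 0 <= B := le_trans (normr_ge0 _) (fB 0).
have C0 : 0 <= C := le_trans (normr_ge0 _) (fC ord0 0).
rewrite iter_partial_jacobi //.
(* The a priori bound D / eps blows up, but inserted in the residual estimate it limits the discrete
   Laplacian to 3 D h^2: one D each from regularisation, truncation and right-hand side. The maximum
   principle improves the bound to 3 D / 8, free of eps. *)
have bound t D : (forall x, `|iter_partial t f x| <= D) ->
    forall x, `|jacobi q h (iter_partial t f) n x| <= D.
  move=> tD y; have [_ _ aft] := antiperiodic_class_iter t cf.
  have D0 : 0 <= D := le_trans (normr_ge0 _) (tD 0).
  have iM0 : 0 < M^-1 by rewrite invr_gt0.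
  have res := jacobi_residual iM0 tD (jacobi_bound h n iM0 tD).
  have := @discrete_maximum_principle R k m.+1 (jacobi q h (iter_partial t f) n)
     (D / M^-1) (3%:R * D) isT (jacobi_bound h n iM0 tD)
     (antiperiodic_jacobi q h n aft).
  move=> /(_ _ y) H; apply: le_trans (H _) _; last by lra.
  move=> z; have := res z; rewrite -/q.
  set Dl := discrete_laplacian _ _ _ => rz.
  have -> : Dl = (Dl + h ^+ 2 * iter_partial t f z) - h ^+ 2 * iter_partial t f z.
    by rewrite addrK.
  apply: le_trans (ler_normB _ _) _.
  rewrite [X in _ + X]normrM (ger0_norm (sqr_ge0 h)).
  have h2 := sqr_ge0 h; have := ler_wpM2l h2 (tD z).
  have : (16%:R * q) ^+ n * D <= D.
    by rewrite ler_piMl // (le_trans nM) // invf_le1.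
  have eps_cancel : M^-1 * (D / M^-1) = D by rewrite mulrC divfK // gt_eqF.
  move=> /(ler_wpM2l h2) qD hD; rewrite eps_cancel mulrDr in rz.
  by rewrite -[(2 * M)^-1]/h; lra.
have iM0 : 0 < M^-1 by rewrite invr_gt0.
(* With the bound K = B, regularisation and truncation now cost at most B / (m + 1) each; replacing
   the discrete Laplacian by the true one costs 16 C h. *)
have res := jacobi_residual iM0 fB (bound s B fB) x.
have C3 i y : `|pd i (pd i (pd i (jacobi q h (iter_partial s f) n))) y| <= C.
  have E : pd i (pd i (pd i (jacobi q h (iter_partial s f) n))) =
      jacobi q h (iter_partial [:: i, i, i & s] f) n.
    exact: (iter_partial_jacobi [:: i; i; i] q h n (smooth_iter_partial s sf)).
  rewrite E; apply: bound => z; exact: fC.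
have := discrete_laplacian_approx x
  (smooth_jacobi q h n (smooth_iter_partial s sf)) (ltW h0) C3.
move: res; rewrite -/q; set u := jacobi q h _ n; set Du := discrete_laplacian h u x.
move=> res tay; have h2 : 0 < h ^+ 2 by rewrite exprn_gt0.
rewrite -(ler_pM2l h2) -[X in X * `|_|](gtr0_norm h2) -normrM.
have -> : h ^+ 2 * (laplacian u x + iter_partial s f x) =
   (Du + h ^+ 2 * iter_partial s f x) - (Du - h ^+ 2 * laplacian u x) by ring.
apply: le_trans (ler_normB _ _) _; apply: le_trans (lerD res tay) _.
have -> : 16%:R * C * h ^+ 3 = h ^+ 2 * (16%:R * C * h) by ring.
rewrite -mulrDr ler_wpM2l ?(ltW h2) // [leRHS]mulrDl; apply: lerD.
  by have := ler_wpM2r B0 nM; rewrite -/M; move: (M^-1) => z; lra.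
rewrite ler_wpM2l ?mulr_ge0 // lef_pV2 ?posrE ?mulr_gt0 //.
by rewrite ler_pMl // ler1n.
Qed.

End Jacobi.

(** * Smooth limits of the approximations and exact solutions *)

Section Poisson.
Variable R : realType.
Notation R8 := 'rV[R]_8.
Local Notation e := (@e R).
Implicit Types (f u : R8 -> R) (x v : R8).

(** A quadratic error is o(|v|), so it exhibits the derivative without prior regularity of f; limits
    known only pointwise are differentiated this way. *)
Lemma differentiable_quadratic f x (c : 'I_8 -> R) K :
  (forall v, `|f (x + v) - f x - \sum_i v 0 i * c i| <= K * `|v| ^+ 2) ->
  differentiable f x /\ forall i, pd i f x = c i.
Proof.
move=> fK.
pose L v := \sum_i v 0 i * c i.
have linL : linear (L : R8 -> R).
  move=> a v w; rewrite /L scaler_sumr -big_split; apply: eq_bigr => i _ /=.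
  by rewrite !mxE mulrDl -mulrA.
pose LL : {linear R8 -> R} := HB.pack (L : R8 -> R)
  (GRing.isLinear.Build _ _ _ _ _ linL).
have cL : continuous LL by exact: mx_linear_continuous.
have fL (eps : {posnum R}) :
    \forall v \near (0 : R8), `|f (v + x) - (f x + L v)| <= eps%:num * `|v|.
  have K0 : 0 < `|K| + 1 by rewrite ltr_pwDr.
  have d0 : 0 < eps%:num / (`|K| + 1) by rewrite divr_gt0.
  apply: filterS (nbhsx_ballx (0 : R8) _ d0) => v /=.
  rewrite -ball_normE /= sub0r normrN => vd.
  rewrite opprD addrA [v + x]addrC.
  apply: le_trans (fK v) _; rewrite expr2 mulrA ler_wpM2r //.
  apply: le_trans (_ : (`|K| + 1) * `|v| <= _).
    by rewrite ler_wpM2r // (le_trans (ler_norm K)) // lerDl.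
  by rewrite mulrC -ler_pdivlMr // ltW.
have dE : 'd f x = LL :> (R8 -> R).
  by apply: diff_unique => //; apply/eqaddoP => _ /posnumP[eps]; exact: fL.
have df : differentiable f x.
  apply/diff_locallyP; rewrite dE; split=> //.
  by apply/eqaddoP => _ /posnumP[eps]; exact: fL.
split=> // i; rewrite /pd deriveE // dE /= /L (bigD1 i) //= big1.
  by rewrite addr0 mxE !eqxx mul1r.
by move=> j ji; rewrite mxE (negPf ji) andbF mul0r.
Qed.

(** The intervals of radius D / (m + 1) around a m meet pairwise, so the supremum of their left ends
    lies in all of them; this yields the limit together with its rate. *)
Lemma cauchy_rate (a : nat -> R) D :
  (forall m n, `|a m - a n| <= D / m.+1%:R + D / n.+1%:R) ->
  exists l, forall m, `|a m - l| <= D / m.+1%:R.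
Proof.
move=> aD.
have aD' m n : a m - D / m.+1%:R <= a n + D / n.+1%:R.
  by have := aD m n; rewrite ler_norml; move: (D / _) (D / _) => b c; lra.
pose l := sup (range (fun m => a m - D / m.+1%:R)).
exists l => m; rewrite ler_norml.
have : l <= a m + D / m.+1%:R.
  by apply: ge_sup; [exists (a 0%N - D / 1%:R), 0%N|move=> _ [n _ <-]].
have : a m - D / m.+1%:R <= l.
  by apply: ub_le_sup; [exists (a 0%N + D / 1%:R) => _ [n _ <-]|exists m].
by move: (D / _) => b; lra.
Qed.

Lemma archimedean_le (a b E : R) : (forall m : nat, a <= b + E / m.+1%:R) -> a <= b.
Proof.
move=> ab; apply/ler_addgt0Pr => eps eps0.
have [[//|m] _ mE] := archimedean_inv E eps0.
by apply: le_trans (ab m) _; rewrite lerD2l.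
Qed.

Section Limit.
Variables (u : nat -> R8 -> R) (F : seq 'I_8 -> R8 -> R) (K D : seq 'I_8 -> R).
Hypothesis smoothu : forall m, smooth (u m).
Hypothesis boundu : forall s m x, `|iter_partial s (u m) x| <= K s.
Hypothesis limu : forall s m x,
  `|iter_partial s (u m) x - F s x| <= D s / m.+1%:R.

(** With x and v fixed, let m grow in [quadratic_bound] for [iter_partial s (u m)]. Its constant
    depends only on the uniform bounds [K], so [F s] inherits the estimate with the [F (i :: s)] as
    first-order coefficients. *)
Lemma limit_derivative s x : differentiable (F s) x /\
  forall i, pd i (F s) x = F (i :: s) x.
Proof.
have K0 t : 0 <= K t := le_trans (normr_ge0 _) (boundu t 0 0).
have D0 t : 0 <= D t.
  by have := le_trans (normr_ge0 _) (limu t 0 0); rewrite divr1.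
pose C := \sum_i \sum_j K [:: i, j & s].
have KC i j : K [:: i, j & s] <= C.
  rewrite /C (bigD1 i) //= (bigD1 j) //= -addrA lerDl addr_ge0 //.
    exact: sumr_ge0.
  by apply: sumr_ge0 => i' _; exact: sumr_ge0.
apply: (@differentiable_quadratic _ _ _ (64%:R * C)) => v.
apply: (@archimedean_le _ _ (2 * D s + \sum_i `|v 0 i| * D (i :: s))) => m.
pose g := iter_partial s (u m).
pose A := g (x + v) - g x - \sum_i v 0 i *: pd i g x.
pose B := F s (x + v) - F s x - \sum_i v 0 i * F (i :: s) x.
have H := @quadratic_bound R g x v C (smooth_iter_partial s (smoothu m)).
have {}H : `|A| <= 64%:R * C * `|v| ^+ 2.
  by apply: H => i j y; apply: le_trans (KC i j); exact: (boundu [:: i, j & s]).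
rewrite -/B -[B](subrK A) addrC; apply: le_trans (ler_normD _ _) _.
apply: lerD => //.
have -> : B - A = (F s (x + v) - iter_partial s (u m) (x + v))
   - (F s x - iter_partial s (u m) x)
   - \sum_i v 0 i * (F (i :: s) x - iter_partial (i :: s) (u m) x).
  rewrite /A /B; under [in RHS]eq_bigr do rewrite mulrBr.
  rewrite sumrB; set S1 := \sum_i _; set S2 := \sum_i _.
  by rewrite -/g /S1 /S2; ring.
apply: le_trans (ler_normB _ _) _; rewrite mulrDl; apply: lerD.
  apply: le_trans (ler_normB _ _) _; rewrite mulr2n mulrDl mul1r mulrDl.
  by apply: lerD; rewrite distrC; exact: limu.
apply: le_trans (ler_norm_sum _ _ _) _; rewrite mulr_suml; apply: ler_sum => i _.
by rewrite normrM -mulrA ler_wpM2l // distrC; exact: limu.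
Qed.

Lemma limit_smooth s : smooth (F [::]) /\ iter_partial s (F [::]) = F s.
Proof.
have E t : iter_partial t (F [::]) = F t.
  elim: t => [//|i t IH]; rewrite iter_partial_cons IH; apply/funext => x.
  by have [_] := limit_derivative t x.
by split=> // t x; rewrite E; have [] := limit_derivative t x.
Qed.

End Limit.

Lemma poisson_exists k f : antiperiodic_class k f ->
  exists2 u, antiperiodic_class k u & forall x, laplacian u x = f x.
Proof.
(* [poisson_approx] treats - Delta u = f, so it is applied to - f. *)
move=> cf0; pose f' x := - f x.
have cf : antiperiodic_class k f'.
  have [sf pf af] := cf0; split; first exact: smoothN.
    by move=> i x; rewrite /f' pf.
  by move=> x; rewrite /f' af.
have [u uP] := poisson_approx cf.
have /choice[B fB] s : exists B : R, forall x, `|iter_partial s f' x| <= B.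
  by apply: (@antiperiodic_class_bounded R k); exact: antiperiodic_class_iter.
have B0 s : 0 <= B s := le_trans (normr_ge0 _) (fB s 0).
pose C s := \sum_i B [:: i, i, i & s].
have fC s i x : `|pd i (pd i (pd i (iter_partial s f'))) x| <= C s.
  apply: le_trans (fB [:: i, i, i & s] x) _.
  by rewrite /C (bigD1 i) //= lerDl sumr_ge0.
pose D s := 2 * B s + 16%:R * C s.
have lapu s m x : `|laplacian (iter_partial s (u m)) x + iter_partial s f' x|
    <= D s / m.+1%:R.
  by have [_ H] := uP m; apply: H; [exact: fB | exact: fC].
have D0 s : 0 <= D s.
  by have := le_trans (normr_ge0 _) (lapu s 0 0); rewrite divr1.
have cu s m : antiperiodic_class k (iter_partial s (u m)).
  by apply: antiperiodic_class_iter; case: (uP m).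
(* The Laplacian of a difference of approximations is a difference of residuals, so
   [laplacian_bound] turns residual decay into a Cauchy rate for every derivative. *)
have cau s x m n : `|iter_partial s (u m) x - iter_partial s (u n) x|
    <= D s / m.+1%:R + D s / n.+1%:R.
  have cb := antiperiodic_classB (cu s m) (cu s n).
  have [su _ _] := cu s m; have [sv _ _] := cu s n.
  have lapB y : laplacian (fun x => iter_partial s (u m) x - iter_partial s (u n) x) y
    = (laplacian (iter_partial s (u m)) y + iter_partial s f' y)
      - (laplacian (iter_partial s (u n)) y + iter_partial s f' y).
    rewrite laplacianB //.
    move: (laplacian _ y) (laplacian _ y) (iter_partial s f' y) => p q r; ring.
  have lb y : `|laplacian (fun x => iter_partial s (u m) x - iter_partial s (u n) x) y|
    <= D s / m.+1%:R + D s / n.+1%:R.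
    by rewrite lapB; apply: le_trans (ler_normB _ _) _; apply: lerD.
  apply: le_trans (laplacian_bound cb lb x) _.
  by rewrite ler_pdivrMr // ler_peMr ?ler1n // addr_ge0 // divr_ge0.
have /choice[F limF] s : exists G : R8 -> R, forall x m,
    `|iter_partial s (u m) x - G x| <= D s / m.+1%:R.
  have /choice[G GP] x : exists l : R, forall m,
      `|iter_partial s (u m) x - l| <= D s / m.+1%:R.
    by apply: cauchy_rate => m n; exact: cau.
  by exists G.
have bu s m x : `|iter_partial s (u m) x| <= B s + D s.
  apply: le_trans (laplacian_bound (cu s m) (G := B s + D s) _ x) _; last first.
    by rewrite ler_pdivrMr // ler_peMr ?ler1n // addr_ge0.
  move=> y; have Dm : D s / m.+1%:R <= D s.
    by rewrite ler_pdivrMr ?ltr0n // ler_peMr // ler1n.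
  rewrite -[laplacian _ y](addrK (iter_partial s f' y)) addrC.
  rewrite (le_trans (ler_normD _ _)) // normrN lerD //.
  exact: le_trans (lapu s m y) Dm.
have su m : smooth (u m) by case: (uP m) => -[].
have limits := limit_smooth su bu (fun s m x => limF s x m).
have F0 := fun x m => limF [::] x m.
exists (F [::]); last first.
  move=> x; apply/eqP; rewrite -subr_eq0 -normr_le0.
  apply: (@archimedean_le _ _ (D [::] + \sum_i D [:: i; i])) => m.
  rewrite add0r.
  have lapF : laplacian (F [::]) x = \sum_i F [:: i; i] x.
    by apply: eq_bigr => i _; have [_ <-] := limits [:: i; i].
  have lapum : \sum_i iter_partial [:: i; i] (u m) x = laplacian (u m) x by [].
  have -> : laplacian (F [::]) x - f x =
     (laplacian (u m) x + f' x)
     - \sum_i (iter_partial [:: i; i] (u m) x - F [:: i; i] x).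
    rewrite sumrB lapum lapF /f'.
    by move: (laplacian (u m) x) (\sum_i _) => p q; ring.
  apply: le_trans (ler_normB _ _) _; rewrite mulrDl; apply: lerD.
    exact: (lapu [::]).
  apply: le_trans (ler_norm_sum _ _ _) _; rewrite mulr_suml; apply: ler_sum => i _.
  exact: limF.
have closed_eq (a b : R) (va vb : nat -> R) :
    (forall m, `|va m - a| <= D [::] / m.+1%:R) ->
    (forall m, `|vb m - b| <= D [::] / m.+1%:R) -> va =1 vb -> a = b.
  move=> aD bD ab; apply/eqP; rewrite -subr_eq0 -normr_le0.
  apply: (@archimedean_le _ _ (D [::] + D [::])) => m; rewrite add0r mulrDl.
  have := aD m; have := bD m; rewrite (ab m) => H1 H2.
  have -> : a - b = (vb m - b) - (vb m - a) by ring.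
  by apply: le_trans (ler_normB _ _) _; apply: lerD.
split; first by have [] := limits [::].
  move=> i x; apply: (closed_eq _ _ _ _ (F0 _) (F0 _)) => m /=.
  by have [[_ pu _] _] := uP m; exact: pu.
move=> x; apply: (closed_eq _ _ _ (fun m => - u m x) (F0 _)) => [m|m /=].
  by rewrite -opprD normrN; exact: F0.
by have [[_ _ au] _] := uP m; exact: au.
Qed.

End Poisson.

(** * Changes of variables and commuting derivatives *)

Section Symmetry.
Variable R : realType.
Notation R8 := 'rV[R]_8.
Local Notation e := (@e R).

Lemma periodic2_iter_partial (V : normedModType R) s (f : R8 -> V) :
  periodic2 f -> periodic2 (iter_partial s f).
Proof. by move=> pf; elim: s => //= i s; exact: periodic2_pd. Qed.

(* The difference quotients M (f(x + e_j / M) - f(x)) converge to pd j f with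
   all their derivatives. *)
Lemma iter_partial_pdC (f : R8 -> R) s j : smooth f -> periodic2 f ->
  iter_partial s (pd j f) = pd j (iter_partial s f).
Proof.
move=> sf pf.
have bnd t : exists C : R, forall x, `|iter_partial t f x| <= C.
  apply: periodic2_bounded; last exact: periodic2_iter_partial.
  exact/smooth_continuous/smooth_iter_partial.
have [B fB] := choice bnd.
pose v (m : nat) := (m.+1%:R)^-1 *: e j.
pose u (m : nat) (x : R8) : R := m.+1%:R *: (f (x + v m) - f x).
have su m : smooth (u m).
  by apply/smoothZ/smoothB => //; exact: smooth_translate.
have iu t m x : iter_partial t (u m) x =
    m.+1%:R * (iter_partial t f (x + v m) - iter_partial t f x).
  have st := smooth_translate (v m) sf.
  by rewrite iter_partialZ ?iter_partialB ?iter_partial_translate //; exact: smoothB.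
have bu t m x : `|iter_partial t (u m) x| <= B (j :: t).
  rewrite iu normrM ger0_norm // -ler_pdivlMl ?ltr0n // mulrC.
  have := taylor0 x (m.+1%:R^-1) (smooth_iter_partial t sf) (fB (j :: t)).
  by rewrite [`|_^-1|]ger0_norm.
have lu t m x : `|iter_partial t (u m) x - pd j (iter_partial t f) x|
    <= B [:: j, j & t] / m.+1%:R.
  have M0 : 0 < m.+1%:R :> R by rewrite ltr0n.
  have := taylor1 x (m.+1%:R^-1) (smooth_iter_partial t sf) (fB [:: j, j & t]).
  rewrite iu [`|_^-1|]ger0_norm // -/(v m) => H.
  have -> : m.+1%:R * (iter_partial t f (x + v m) - iter_partial t f x)
     - pd j (iter_partial t f) x =
     m.+1%:R * (iter_partial t f (x + v m) - iter_partial t f x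
     - m.+1%:R^-1 * pd j (iter_partial t f) x) by rewrite [RHS]mulrBr mulVKf ?gt_eqF.
  rewrite normrM ger0_norm // mulrC -ler_pdivlMr //.
  by apply: le_trans H _; rewrite expr2 mulrA.
(* For this F, the conclusion [iter_partial s (F [::]) = F s] is the commutation itself. *)
by have [_] := limit_smooth su bu (F := fun t => pd j (iter_partial t f)) lu s.
Qed.

Lemma pdC_scalar (f : R8 -> R) i j : smooth f -> periodic2 f ->
  pd i (pd j f) = pd j (pd i f).
Proof. by move=> sf pf; exact: (iter_partial_pdC [:: i]). Qed.

Section Affine.
Variables (V : normedModType R) (s b : seq R).
Implicit Types f : R8 -> V.
Local Notation g := (diag_affine s b).

Lemma diag_affine_shift (h : R) i x :
  g (h *: e i + x) = h *: (s`_i *: e i) + g x.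
Proof.
apply/rowP => j; rewrite !mxE; have [->|ji] := eqVneq j i; rewrite ?mulr1 ?mulr0; ring.
Qed.

Lemma differentiable_diag_affine x : differentiable g x.
Proof.
pose L : {linear R8 -> R8} := mulmxr (diag_mx (\row_i s`_i)).
have -> : g = fun y => L y + \row_i b`_i.
  apply/funext => y; apply/rowP => j; rewrite !mxE (bigD1 j) //= big1 => [|i ij].
    by rewrite addr0 !mxE eqxx mulr1n mulrC.
  by rewrite !mxE (negPf ij) mulr0n mulr0.
apply: differentiableD => //.
by apply: linear_differentiable; exact: mx_linear_continuous.
Qed.

Lemma pd_diag_affine i f : (forall x, differentiable f x) ->
  pd i (f \o g) = fun x => s`_i *: pd i f (g x).
Proof.
move=> df; apply/funext => x.
rewrite /pd deriveE; last first.
  by apply: differentiable_comp => //; exact: differentiable_diag_affine.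
have -> : 'd (f \o g) x (e i) = 'D_(e i) (f \o g) x.
  rewrite deriveE //; apply: differentiable_comp => //.
  exact: differentiable_diag_affine.
have -> : 'D_(e i) (f \o g) x = 'D_(s`_i *: e i) f (g x).
  rewrite /derive (_ : (fun h : R => _) = fun h : R =>
    h^-1 *: ((f \o shift (g x)) (h *: (s`_i *: e i)) - f (g x))) //.
  by apply/funext => h /=; rewrite diag_affine_shift.
by rewrite !deriveE // linearZ.
Qed.

Lemma iter_partial_diag_affine t f : smooth f ->
  iter_partial t (f \o g) =
  fun x => (\prod_(i <- t) s`_i) *: iter_partial t f (g x).
Proof.
move=> sf; elim: t => [|i t IH].
  by apply/funext => x; rewrite big_nil scale1r.
have dt x : differentiable (iter_partial t f) x by exact: sf.
rewrite iter_partial_cons IH pdZ; last first.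
  by move=> x; apply: differentiable_comp => //; exact: differentiable_diag_affine.
apply/funext => x; rewrite pd_diag_affine // big_cons scalerA mulrC.
by [].
Qed.

Lemma smooth_diag_affine f : smooth f -> smooth (f \o g).
Proof.
move=> sf t x; rewrite iter_partial_diag_affine //; apply: differentiableZ.
apply: differentiable_comp; first exact: differentiable_diag_affine.
exact: sf.
Qed.

Lemma laplacian_diag_affine f x : smooth f ->
  (forall i : 'I_8, s`_i * s`_i = 1) ->
  laplacian (f \o g) x = laplacian f (g x).
Proof.
move=> sf s1; apply: eq_bigr => i _.
rewrite -[LHS]/(iter_partial [:: i; i] (f \o g) x) iter_partial_diag_affine //.
by rewrite 2!big_cons big_nil mulr1 s1 scale1r.
Qed.

End Affine.

Lemma laplacian_linear (V W : normedModType R) (L : {linear V -> W}) f :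
  continuous L -> smooth f -> laplacian (L \o f) = L \o laplacian f.
Proof.
move=> cL sf; apply/funext => x; rewrite /laplacian /= linear_sum.
apply: eq_bigr => i _.
by rewrite -[LHS]/(iter_partial [:: i; i] _ x) iter_partial_comp_linear.
Qed.

Lemma laplacianZ (V : normedModType R) (c : R) (f : R8 -> V) x :
  smooth f -> laplacian (fun x => c *: f x) x = c *: laplacian f x.
Proof.
move=> sf; rewrite /laplacian scaler_sumr; apply: eq_bigr => i _.
by rewrite -[LHS]/(iter_partial [:: i; i] _ x) iter_partialZ.
Qed.

Lemma laplacian_sum (V : normedModType R) (I : Type) (r : seq I) (P : pred I)
    (F : I -> R8 -> V) x : (forall i, P i -> smooth (F i)) ->
  laplacian (fun x => \sum_(i <- r | P i) F i x) x =
  \sum_(i <- r | P i) laplacian (F i) x.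
Proof.
move=> sF; rewrite /laplacian exchange_big /=; apply: eq_bigr => i _.
by rewrite -[LHS]/(iter_partial [:: i; i] _ x) iter_partial_sum.
Qed.

Lemma laplacian_translate (V : normedModType R) (v : R8) (f : R8 -> V) x :
  laplacian (fun x => f (x + v)) x = laplacian f (x + v).
Proof.
apply: eq_bigr => i _.
by rewrite -[LHS]/(iter_partial [:: i; i] _ x) iter_partial_translate.
Qed.

(** [poisson_exists] controls the sign under a unit shift along k only. For another direction l, u
    (x + e l) - c u x is harmonic and still antiperiodic along k, hence zero. *)
Lemma poisson_equivariant k (f : R8 -> R) : antiperiodic_class k f ->
  exists2 u, antiperiodic_class k u & (forall x, laplacian u x = f x) /\
    forall l c, (forall x, f (x + e l) = c * f x) ->
      forall x, u (x + e l) = c * u x.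
Proof.
move=> cf; have [u cu uf] := poisson_exists cf.
exists u => //; split=> // l c fl x.
have [su pu au] := cu.
apply/eqP; rewrite -subr_eq0; apply/eqP.
have st := smooth_translate (e l) su.
have sc : smooth (fun x => c * u x) by exact: (smoothZ c su).
have cd : antiperiodic_class k (fun x => u (x + e l) - c * u x).
  split; first exact: smoothB.
    by move=> i y; rewrite addrAC !pu.
  by move=> y; rewrite addrAC !au mulrN -opprD.
apply: (laplacian_eq0 cd) => y.
rewrite laplacianB // laplacian_translate !uf.
have -> : laplacian (fun x => c * u x) y = c * laplacian u y.
  exact: (laplacianZ c y su).
by rewrite uf fl subrr.
Qed.

End Symmetry.

(** * The Poisson equation with values in a flat bundle *)

Section TwistedPoisson.
Variable R : realType.
Notation R8 := 'rV[R]_8.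
Local Notation e := (@e R).

(** Packaged as a linear map, like [conj_mx] and [scalel], so that derivatives and the Laplacian
    pass through it by the general lemmas. *)
Definition conj_entry (A B : 'M[R]_8) i j : 'M[R]_8 -> R :=
  fun M => (A *m M *m B) i j.

Lemma conj_entry_linear A B i j : linear (conj_entry A B i j : _ -> R^o).
Proof.
move=> a M N; rewrite /conj_entry mulmxDr mulmxDl -scalemxAr -scalemxAl.
by rewrite !mxE.
Qed.

HB.instance Definition _ A B i j := GRing.isLinear.Build R 'M[R]_8 R^o *:%R
  (conj_entry A B i j) (@conj_entry_linear A B i j).

Definition conj_mx (A B : 'M[R]_8) : 'M[R]_8 -> 'M[R]_8 := fun M => A *m M *m B.

Lemma conj_mx_linear A B : linear (conj_mx A B).
Proof.
by move=> a M N; rewrite /conj_mx mulmxDr mulmxDl -scalemxAr -scalemxAl.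
Qed.

HB.instance Definition _ A B := GRing.isLinear.Build R 'M[R]_8 'M[R]_8 *:%R
  (conj_mx A B) (@conj_mx_linear A B).

Definition scalel (C : 'M[R]_8) : R -> 'M[R]_8 := fun r => r *: C.

Lemma scalel_linear C : linear (scalel C : R^o -> 'M[R]_8).
Proof. by move=> a r t; rewrite /scalel scalerDl scalerA. Qed.

HB.instance Definition _ C := GRing.isLinear.Build R R^o 'M[R]_8 *:%R
  (scalel C) (@scalel_linear C).

Lemma conj_entry_smooth A B i j (F : R8 -> 'M[R]_8) : smooth F ->
  smooth (conj_entry A B i j \o F) /\
  forall s, iter_partial s (conj_entry A B i j \o F) =
            conj_entry A B i j \o iter_partial s F.
Proof.
move=> sF.
have cL : continuous (conj_entry A B i j : _ -> R^o) by exact: mx_linear_continuous.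
split; first exact: (smooth_comp_linear cL sF).
by move=> s; exact: (iter_partial_comp_linear s cL sF).
Qed.

Lemma smooth_conj_mx A B (F : R8 -> 'M[R]_8) : smooth F ->
  smooth (conj_mx A B \o F).
Proof. by apply: smooth_comp_linear; exact: mx_linear_continuous. Qed.

Lemma iter_partial_conj_mx A B s (F : R8 -> 'M[R]_8) : smooth F ->
  iter_partial s (conj_mx A B \o F) = conj_mx A B \o iter_partial s F.
Proof. by apply: iter_partial_comp_linear; exact: mx_linear_continuous. Qed.

Lemma smooth_trmx (F : R8 -> 'M[R]_8) : smooth F -> smooth (trmx \o F).
Proof. by apply: smooth_comp_linear; exact: mx_linear_continuous. Qed.

Lemma laplacian_trmx (F : R8 -> 'M[R]_8) x : smooth F ->
  laplacian (trmx \o F) x = (laplacian F x)^T.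
Proof.
move=> sF.
by rewrite (laplacian_linear (L := @trmx R 8 8)) //; exact: mx_linear_continuous.
Qed.

Lemma laplacian_conj_mx A B (F : R8 -> 'M[R]_8) x : smooth F ->
  laplacian (conj_mx A B \o F) x = A *m laplacian F x *m B.
Proof.
move=> sF.
by rewrite (laplacian_linear (L := conj_mx A B)) //; exact: mx_linear_continuous.
Qed.

Lemma laplacian_conj_entry A B i j (F : R8 -> 'M[R]_8) x : smooth F ->
  laplacian (conj_entry A B i j \o F) x = (A *m laplacian F x *m B) i j.
Proof.
move=> sF.
have cL : continuous (conj_entry A B i j : _ -> R^o) by exact: mx_linear_continuous.
exact: (congr1 (fun h => h x) (laplacian_linear cL sF)).
Qed.

Lemma scalel_smooth C (u : R8 -> R) : smooth u ->
  smooth (fun x => u x *: C : 'M[R]_8) /\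
  forall x, laplacian (fun x => u x *: C : 'M[R]_8) x = (laplacian u x : R) *: C.
Proof.
move=> su.
have cL : continuous (scalel C : R^o -> _) by exact: scalel_continuous.
split; first exact: (smooth_comp_linear cL su).
by move=> x; exact: (congr1 (fun h => h x) (laplacian_linear cL su)).
Qed.

Lemma conj1_entry (M : 'M[R]_8) i j : conj_entry 1%:M 1%:M i j M = M i j.
Proof. by rewrite /conj_entry mul1mx mulmx1. Qed.

Lemma iter_partial_entry s (F : R8 -> 'M[R]_8) i j x : smooth F ->
  iter_partial s F x i j = iter_partial s (fun y => F y i j) x.
Proof.
move=> sF; have [_ H] := conj_entry_smooth 1%:M 1%:M i j sF.
rewrite -[LHS]conj1_entry -[LHS]/((conj_entry 1%:M 1%:M i j \o iter_partial s F) x) -H.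
by congr (iter_partial s _ x); apply/funext => y; exact: conj1_entry.
Qed.

Lemma smooth_entry (F : R8 -> 'M[R]_8) i j : smooth F ->
  smooth (fun y => F y i j).
Proof.
move=> sF; have [H _] := conj_entry_smooth 1%:M 1%:M i j sF.
have -> : (fun y => F y i j) = conj_entry 1%:M 1%:M i j \o F.
  by apply/funext => y /=; rewrite conj1_entry.
exact: H.
Qed.

Lemma pdC (F : R8 -> 'M[R]_8) i j : smooth F -> periodic2 F ->
  pd i (pd j F) = pd j (pd i F).
Proof.
move=> sF pF; apply/funext => x; apply/matrixP => r c.
have E a b : pd a (pd b F) x r c = pd a (pd b (fun y => F y r c)) x.
  exact: (iter_partial_entry [:: a; b] r c x sF).
apply: etrans (E i j) _; apply: etrans (esym (E j i)).
apply: (congr1 (fun h => h x)); apply: pdC_scalar; first exact: smooth_entry.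
by move=> l y; rewrite pF.
Qed.

Lemma iter_partial_pd_mx (F : R8 -> 'M[R]_8) i s : smooth F -> periodic2 F ->
  iter_partial s (pd i F) = pd i (iter_partial s F).
Proof.
move=> sF pF; elim: s => [//|j s IH].
rewrite !iter_partial_cons IH pdC //; first exact: smooth_iter_partial.
exact: periodic2_iter_partial.
Qed.

Lemma laplacian_pd_mx (F : R8 -> 'M[R]_8) i : smooth F -> periodic2 F ->
  laplacian (pd i F) = pd i (laplacian F).
Proof.
move=> sF pF; rewrite -[pd i (laplacian F)]/(iter_partial [:: i] _).
rewrite iter_partial_sum; last by move=> j _; do 2 apply: smooth_pd.
apply/funext => x; apply: eq_bigr => j _.
exact: (congr1 (fun h => h x) (iter_partial_pd_mx i [:: j; j] sF pF)).
Qed.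

Lemma conj_sum_delta (A B : 'M[R]_8) (W : 'I_8 -> 'I_8 -> R) :
  A *m (\matrix_(i, j) W i j) *m B =
  \sum_p W p.1 p.2 *: (A *m delta_mx p.1 p.2 *m B).
Proof.
rewrite (matrix_sum_delta (\matrix_(i, j) _)) pair_bigA mulmx_sumr mulmx_suml.
by apply: eq_bigr => -[i j] _ /=; rewrite mxE -scalemxAr -scalemxAl.
Qed.

(** The columns of P are joint eigenvectors of the involutions T k, with eigenvalues d k. By [sepS]
    any two joint characters take opposite values at some k, which makes each off-diagonal entry
    antiperiodic in some direction. *)
Variables (S : {pred 'I_8}) (T : 'I_8 -> 'M[R]_8) (P : 'M[R]_8).
Variable (d : 'I_8 -> 'rV[R]_8).
Hypothesis unitP : P \in unitmx.
Hypothesis diagT : forall k, k \in S -> invmx P *m T k *m P = diag_mx (d k).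
Hypothesis symT : forall k, k \in S -> (T k)^T = T k.
Hypothesis invoT : forall k, k \in S -> T k *m T k = 1%:M.
Hypothesis sepS : forall i j : 'I_8, i != j -> exists2 k, k \in S & d k 0 i * d k 0 j = -1.

Definition twisted_class (F : R8 -> 'M[R]_8) :=
  [/\ smooth F, periodic2 F, forall x, (F x)^T = - F x &
      forall k, k \in S -> forall x, F (x + e k) = T k *m F x *m T k].

Lemma TP k : k \in S -> T k *m P = P *m diag_mx (d k).
Proof. by move=> kS; rewrite -diagT // !mulmxA mulmxV // mul1mx. Qed.

Lemma PT k : k \in S -> invmx P *m T k = diag_mx (d k) *m invmx P.
Proof. by move=> kS; rewrite -diagT // -!mulmxA mulmxV // mulmx1. Qed.

Lemma sep_neq (i j : 'I_8) : i != j -> exists2 k, k \in S & d k 0 i != d k 0 j.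
Proof.
move=> /sepS[k kS dk]; exists k => //; apply: contra_eqN dk => /eqP ->.
rewrite -expr2 -subr_eq0 opprK; apply: lt0r_neq0.
by rewrite ltr_pwDr // sqr_ge0.
Qed.

Lemma commute_diag M : (forall k, k \in S -> M *m diag_mx (d k) = diag_mx (d k) *m M) ->
  forall i j : 'I_8, i != j -> M i j = 0.
Proof.
move=> Md i j /sep_neq[k kS dk]; have := congr1 (fun N : 'M[R]_8 => N i j) (Md k kS).
rewrite mul_mx_diag mul_diag_mx !mxE => /eqP.
rewrite mulrC -subr_eq0 -mulrBl mulf_eq0 subr_eq0 eq_sym (negPf dk) /=.
by move/eqP.
Qed.

(** Symmetry of T k makes the Gram matrix commute with every diagonal matrix of eigenvalues; as the
    characters are distinct, the columns of P are orthogonal. *)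
Lemma gram_diag (i j : 'I_8) : i != j -> (P^T *m P) i j = 0.
Proof.
apply: commute_diag => k kS.
rewrite -mulmxA -TP // mulmxA -[X in _ *m X *m _](symT kS) -trmx_mul TP //.
by rewrite trmx_mul tr_diag_mx mulmxA.
Qed.

Lemma gram_diag_neq0 i : (P^T *m P) i i != 0.
Proof.
set M := P^T *m P; have uM : M \in unitmx by rewrite unitmx_mul unitmx_tr unitP.
have := congr1 (fun N : 'M[R]_8 => N i i) (mulmxV uM).
rewrite [LHS]mxE [RHS]mxE (bigD1 i) //= big1 => [|j ji]; last first.
  by rewrite gram_diag ?mul0r // eq_sym.
by rewrite eqxx addr0; apply: contra_eq_neq => ->; rewrite mul0r eq_sym oner_eq0.
Qed.

(** P^T X P is skew and equals the Gram matrix times the conjugate of X. The Gram matrix being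
    diagonal and invertible, zero diagonal entries pass to the conjugate. *)
Lemma skew_conj_diag0 (X : 'M[R]_8) i : X^T = - X -> (invmx P *m X *m P) i i = 0.
Proof.
move=> skX; set Y := invmx P *m X *m P.
have E : P^T *m X *m P = P^T *m P *m Y.
  by rewrite /Y !mulmxA mulmxK // -!mulmxA.
have : (P^T *m X *m P)^T = - (P^T *m X *m P).
  by rewrite !trmx_mul trmxK skX mulNmx mulmxN mulmxA.
move=> /(congr1 (fun N : 'M[R]_8 => N i i)); rewrite [LHS]mxE [RHS]mxE E => /eqP.
rewrite -subr_eq0 opprK -mulr2n mulrn_eq0 /= mxE (bigD1 i) //= big1 => [|j ji].
  by rewrite addr0 mulf_eq0 (negPf (gram_diag_neq0 i)) => /eqP.
by rewrite gram_diag ?mul0r // eq_sym.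
Qed.

Definition entry F i j : R8 -> R := conj_entry (invmx P) P i j \o F.

Lemma entry_shift F i j k x : twisted_class F -> k \in S ->
  entry F i j (x + e k) = (d k 0 i * d k 0 j) * entry F i j x.
Proof.
move=> [_ _ _ eF] kS; rewrite /entry /= /conj_entry eF // !mulmxA PT //.
rewrite -(mulmxA _ (T k) P) TP // (mulmxA _ P).
by rewrite mul_mx_diag mxE -!mulmxA mul_diag_mx mxE mulrAC.
Qed.

Lemma entry_class F i j : twisted_class F -> i != j ->
  exists2 k, k \in S & antiperiodic_class k (entry F i j).
Proof.
move=> cF /sepS[k kS dk]; exists k => //; have [sF pF _ _] := cF; split.
- by have [] := conj_entry_smooth (invmx P) P i j sF.
- by move=> l x; rewrite /entry /= pF.
- by move=> x; rewrite entry_shift // dk mulN1r.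
Qed.

Lemma twisted_eq0 F : twisted_class F -> (forall x, laplacian F x = 0) ->
  forall x, F x = 0.
Proof.
move=> cF lF x; have [sF pF kF _] := cF.
suff E : invmx P *m F x *m P = 0.
  have -> : F x = P *m (invmx P *m F x *m P) *m invmx P.
    by rewrite !mulmxA mulmxK // mulmxV // mul1mx.
  by rewrite E mulmx0 mul0mx.
apply/matrixP => i j; rewrite [RHS]mxE; have [->|ij] := eqVneq i j.
  exact: skew_conj_diag0.
have [k _ ce] := entry_class cF ij.
apply: (laplacian_eq0 ce) => y; rewrite laplacian_conj_entry // lF.
by rewrite mulmx0 mul0mx mxE.
Qed.

Lemma twistedB F G : twisted_class F -> twisted_class G ->
  twisted_class (fun x => F x - G x).
Proof.
move=> [sF pF kF eF] [sG pG kG eG]; split.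
- exact: smoothB.
- by move=> i x; rewrite pF pG.
- by move=> x; rewrite linearB /= kF kG opprB opprK addrC.
- by move=> k kS x; rewrite eF // eG // mulmxBr mulmxBl.
Qed.

Lemma twistedZ c F : twisted_class F -> twisted_class (fun x => c *: F x).
Proof.
move=> [sF pF kF eF]; split.
- exact: smoothZ.
- by move=> i x; rewrite pF.
- by move=> x; rewrite linearZ /= kF scalerN.
- by move=> k kS x; rewrite eF // -scalemxAr -scalemxAl.
Qed.

Lemma twisted_sum (I : Type) (r : seq I) (Q : pred I) (F : I -> R8 -> 'M[R]_8) :
  (forall i, Q i -> twisted_class (F i)) ->
  twisted_class (fun x => \sum_(i <- r | Q i) F i x).
Proof.
move=> cF; split.
- by apply: smooth_sum => i /cF[].
- by move=> k x; apply: eq_bigr => i /cF[_ pF _ _]; exact: pF.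
- by move=> x; rewrite linear_sum -sumrN; apply: eq_bigr => i /cF[_ _ kF _]; exact: kF.
- move=> k kS x; rewrite mulmx_sumr mulmx_suml; apply: eq_bigr => i /cF[_ _ _ eF].
  exact: eF.
Qed.

Lemma twisted_pd i F : twisted_class F -> twisted_class (pd i F).
Proof.
move=> [sF pF kF eF]; split; [exact: smooth_pd | exact: periodic2_pd | |].
  have E : trmx \o F = fun x => - F x by apply/funext.
  have cT : continuous (@trmx R 8 8) by exact: mx_linear_continuous.
  have := iter_partial_comp_linear (L := @trmx R 8 8) [:: i] cT sF.
  rewrite E iter_partialN // => H x.
  exact: (esym (congr1 (fun h => h x) H)).
move=> k kS x; rewrite -[LHS]/((fun y => pd i F (y + e k)) x) -pd_translate.
have -> : (fun y => F (y + e k)) = conj_mx (T k) (T k) \o F.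
  by apply/funext => y; exact: eF.
exact: (congr1 (fun h => h x) (iter_partial_conj_mx (T k) (T k) [:: i] sF)).
Qed.

Lemma twisted_exists F : twisted_class F ->
  exists2 U, twisted_class U & forall x, laplacian U x = F x.
Proof.
move=> cF; have [sF pF kF _] := cF.
have /choice[u uP] : forall p : 'I_8 * 'I_8, exists u : R8 -> R,
    [/\ smooth u, periodic2 u, forall x, laplacian u x = entry F p.1 p.2 x &
        forall k, k \in S -> forall x,
          u (x + e k) = (d k 0 p.1 * d k 0 p.2) * u x].
  move=> [i j] /=; have [->|ij] := eqVneq i j.
    (* No direction makes a diagonal entry antiperiodic, but such entries of the skew F vanish. *)
    exists (fun=> 0); split=> //; first exact: smooth0.
      move=> x; rewrite /entry /= /conj_entry skew_conj_diag0 //.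
      by rewrite /laplacian big1 // => l _; rewrite !pd_cst.
    by move=> k _ x; rewrite mulr0.
  have [k kS ce] := entry_class cF ij.
  have [u [su pu _] [lu eu]] := poisson_equivariant ce.
  exists u; split=> // l lS x; apply: eu => y; exact: entry_shift.
pose V x := \sum_p u p x *: (P *m delta_mx p.1 p.2 *m invmx P).
have VE x : V x = P *m (\matrix_(i, j) u (i, j) x) *m invmx P.
  by rewrite conj_sum_delta; apply: eq_bigr => -[i j] _.
have sV : smooth V.
  by apply: smooth_sum => p _; have [su _ _ _] := uP p; case: (scalel_smooth (P *m delta_mx p.1 p.2 *m invmx P) su).
have pV : periodic2 V.
  by move=> i x; apply: eq_bigr => p _; have [_ pu _ _] := uP p; rewrite pu.
have lV x : laplacian V x = F x.
  rewrite laplacian_sum => [|p _]; last first.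
    by have [su _ _ _] := uP p; case: (scalel_smooth (P *m delta_mx p.1 p.2 *m invmx P) su).
  transitivity (P *m (\matrix_(i, j) entry F i j x) *m invmx P); last first.
    rewrite (_ : \matrix_(i, j) _ = invmx P *m F x *m P); last first.
      by apply/matrixP => i j; rewrite mxE.
    by rewrite !mulmxA mulmxK // mulmxV // mul1mx.
  rewrite conj_sum_delta; apply: eq_bigr => -[i j] _ /=; have [su _ lu _] := uP (i, j).
  have [_ ->] := scalel_smooth (P *m delta_mx i j *m invmx P) su.
  by rewrite lu.
have eV k x : k \in S -> V (x + e k) = T k *m V x *m T k.
  move=> kS; rewrite !VE !mulmxA TP // -[RHS]mulmxA PT // !mulmxA.
  congr (_ *m invmx P); rewrite -!mulmxA; congr (P *m _).
  apply/matrixP => i j; rewrite mul_diag_mx mul_mx_diag !mxE.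
  have [_ _ _ ->] := uP (i, j); rewrite //= mulrA.
  by rewrite mulrAC.
have sVT := smooth_trmx sV.
(* Solving entry by entry in a non-orthonormal basis does not make V visibly skew. Its skew part has
   the same Laplacian, since F is skew, and the same equivariance, since the T k are symmetric. *)
exists (fun x => 2^-1 *: (V x - (V x)^T)); last first.
  move=> x; rewrite laplacianZ; last exact: smoothB.
  rewrite laplacianB // -[fun x => (V x)^T]/(trmx \o V) laplacian_trmx // lV kF.
  by rewrite opprK -mulr2n -(scaler_nat 2 (F x)) scalerA mulVf ?scale1r // pnatr_eq0.
split.
- by apply: smoothZ; exact: smoothB.
- by move=> i x; rewrite pV.
- by move=> x; rewrite linearZ linearB /= trmxK -scalerN opprB.
- move=> k kS x; rewrite eV // !trmx_mul symT // -scalemxAr -scalemxAl.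
  by rewrite mulmxBr mulmxBl !mulmxA.
Qed.

Section Action.
Variables (s b : seq R) (A : 'M[R]_8) (c : R).
Hypothesis s_unit : forall i : 'I_8, s`_i = 1 \/ s`_i = -1.
Hypothesis orthA : A *m A^T = 1%:M.
Hypothesis commA : forall k, k \in S -> A *m T k = T k *m A.
Hypothesis cc : c * c = 1.
Local Notation g := (diag_affine s b).

Let orthA' : A^T *m A = 1%:M. Proof. exact: mulmx1C. Qed.

Let commA' k : k \in S -> A^T *m T k = T k *m A^T.
Proof.
by move=> kS; rewrite -[X in _ *m X](symT kS) -trmx_mul -commA // trmx_mul symT.
Qed.

Lemma diag_affine_e (t : R) k x : g (x + t *: e k) = g x + t *: (s`_k *: e k).
Proof. by rewrite addrC diag_affine_shift addrC. Qed.

Lemma twisted_action F : twisted_class F ->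
  twisted_class (fun x => A^T *m F (g x) *m A).
Proof.
move=> [sF pF kF eF]; split.
- exact: (smooth_conj_mx A^T A (smooth_diag_affine s b sF)).
- move=> i x; congr (_ *m _ *m _); rewrite diag_affine_e.
  have [->|->] := s_unit i; first by rewrite scale1r pF.
  by rewrite scaleN1r scalerN -[in LHS](pF i) subrK.
- by move=> x; rewrite !trmx_mul trmxK kF mulNmx mulmxN mulmxA.
- move=> k kS x.
  have -> : F (g (x + e k)) = T k *m F (g x) *m T k.
    rewrite -[e k]scale1r diag_affine_e scale1r.
    have [->|->] := s_unit k; first by rewrite scale1r eF.
    (* Here g reverses direction k; as T k is its own inverse, the backward shift acts as the
       forward one. *)
    rewrite scaleN1r -[in RHS](subrK (e k) (g x)) eF //.
    by rewrite !mulmxA invoT // mul1mx -mulmxA invoT // mulmx1.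
  rewrite !mulmxA commA' // -!mulmxA; congr (_ *m _).
  by rewrite commA.
Qed.

(** c is the sign with which g acts on a component dx_I. The function A^T U(g x) A - c U(x) lies in
    the class and is harmonic, the Laplacian being invariant under sign changes and translations. *)
Lemma twisted_equivariant F U : twisted_class F -> twisted_class U ->
  (forall x, laplacian U x = F x) ->
  (forall x, c *: F (g x) = A *m F x *m A^T) ->
  forall x, c *: U (g x) = A *m U x *m A^T.
Proof.
move=> cF cU UF gF x.
have [sU pU _ _] := cU.
have s1 (i : 'I_8) : s`_i * s`_i = 1.
  by have [->|->] := s_unit i; rewrite ?mulrNN mulr1.
have cG := twisted_action cU.
have [sG _ _ _] := cG.
have cW := twistedB cG (twistedZ c cU).
have : forall y, A^T *m U (g y) *m A - c *: U y = 0.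
  apply: (twisted_eq0 cW) => y.
  rewrite laplacianB //; last exact: smoothZ.
  rewrite laplacianZ // UF.
  have -> : (fun x => A^T *m U (g x) *m A) = conj_mx A^T A \o (U \o g) by [].
  rewrite laplacian_conj_mx; last exact: smooth_diag_affine.
  rewrite laplacian_diag_affine // UF.
  have -> : F (g y) = c *: (A *m F y *m A^T).
    by rewrite -gF scalerA cc scale1r.
  rewrite -scalemxAr -scalemxAl !mulmxA orthA' mul1mx -mulmxA orthA' mulmx1.
  by rewrite subrr.
move=> /(_ x) /subr0_eq E.
have -> : U (g x) = A *m (A^T *m U (g x) *m A) *m A^T.
  by rewrite !mulmxA orthA mul1mx -mulmxA orthA mulmx1.
by rewrite E -scalemxAr -scalemxAl scalerA cc scale1r.
Qed.

End Action.
End TwistedPoisson.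

(** * Forms on R^8 and the projection onto Lambda^2_7 *)

Section FormAlgebra.
Variable R : realType.

(* Finite subsets are given by lists of 0-based indices, so that signs and
   complements can be evaluated by computation. *)
Definition idx_set (s : seq nat) : {set 'I_8} := [set i : 'I_8 | nat_of_ord i \in s]%SET.

Definition list_diff (s t : seq nat) := [seq i <- s | i \notin t].
Definition list_compl (s : seq nat) := list_diff (iota 0 8) s.
Definition list_sub (s t : seq nat) := all (fun i => (i \in s) ==> (i \in t)) (iota 0 8).
Definition list_eqset (s t : seq nat) := list_sub s t && list_sub t s.
Definition inversions (s t : seq nat) :=
  sumn [seq sumn [seq nat_of_bool [&& i \in s, j \in t & j < i] | j <- iota 0 8]
       | i <- iota 0 8]%N.

Lemma idx_setC s : (~: idx_set s)%SET = idx_set (list_compl s).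
Proof.
apply/setP => i; rewrite !inE mem_filter mem_iota /=.
by case: (_ \in s) => //=; rewrite ltn_ord.
Qed.

Lemma idx_setD s t : (idx_set s :\: idx_set t)%SET = idx_set (list_diff s t).
Proof. by apply/setP => i; rewrite !inE mem_filter. Qed.

Lemma idx_set_subset s t : (idx_set s \subset idx_set t) = list_sub s t.
Proof.
apply/fintype.subsetP/allP => [st i|st i].
  rewrite mem_iota /= add0n => i8; apply/implyP => is_.
  by have := st (Ordinal i8); rewrite !inE; apply.
rewrite !inE => is_; have := st (nat_of_ord i).
by rewrite mem_iota /= add0n ltn_ord is_ => /(_ isT).
Qed.

Lemma idx_set_eq s t : (idx_set s == idx_set t) = list_eqset s t.
Proof. by rewrite finset.eqEsubset !idx_set_subset. Qed.

Lemma shuffle_sign_idx_set s t :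
  shuffle_sign R (idx_set s) (idx_set t) = (-1) ^+ inversions s t.
Proof.
rewrite /shuffle_sign; congr (_ ^+ _); rewrite cardsE -sum1_card.
pose F (i j : 'I_8) := nat_of_bool [&& nat_of_ord i \in s, nat_of_ord j \in t & (j < i)%N].
transitivity (\sum_p F p.1 p.2)%N.
  rewrite big_mkcond; apply: eq_bigr => p _.
  by rewrite /F unfold_in /= !inE; case: ifP.
rewrite -(pair_bigA _ F).
have iotaE : iota 0 8 = index_iota 0 8 by [].
rewrite /inversions sumnE big_map iotaE big_mkord; apply: eq_bigr => i _.
by rewrite sumnE big_map big_mkord.
Qed.

(** Formal signed sums of the dx_I: the boolean is the exponent of -1, the list holds the 0-based
    indices of I. *)
Definition sform := seq (bool * seq nat).

Definition coef (l : sform) (J : {set 'I_8}) : R :=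
  \sum_(p <- l) (-1) ^+ p.1 * (J == idx_set p.2)%:R.

Definition contract (V : lmodType R) (l : sform) (w : ext V) : V :=
  \sum_(p <- l) (-1) ^+ p.1 *: w (idx_set p.2).

Lemma sum_coef (V : lmodType R) l (F : {set 'I_8} -> V) :
  \sum_I coef l I *: F I = \sum_(p <- l) (-1) ^+ p.1 *: F (idx_set p.2).
Proof.
under eq_bigr do rewrite /coef scaler_suml.
rewrite exchange_big /=; apply: eq_bigr => p _.
rewrite (bigD1 (idx_set p.2)) //= eqxx mulr1 big1 ?addr0 // => I /negPf ->.
by rewrite mulr0 scale0r.
Qed.

Lemma wedge_coef (V : lmodType R) (a : ext R) l (w : ext V) K :
  (forall J, a J = coef l J) ->
  wedge a w K = \sum_(p <- l) if idx_set p.2 \subset K then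
     (-1) ^+ p.1 *: (shuffle_sign R (idx_set p.2) (K :\: idx_set p.2)%SET
        *: w (K :\: idx_set p.2)%SET) else 0.
Proof.
move=> al; rewrite /wedge ffunE big_mkcond /=.
have H := sum_coef l (fun I : {set 'I_8} => if I \subset K then
    shuffle_sign R I (K :\: I)%SET *: w (K :\: I)%SET else 0).
rewrite (eq_bigr (fun I : {set 'I_8} => coef l I *: (if I \subset K then
    shuffle_sign R I (K :\: I)%SET *: w (K :\: I)%SET else 0))).
  by rewrite H; apply: eq_bigr => p _; case: ifP; rewrite ?scaler0.
by move=> I _; rewrite al; case: ifP; rewrite ?scaler0 // scalerA mulrC.
Qed.

Definition Omega_list : sform :=
  [:: (false, [:: 0; 1; 2; 3]); (false, [:: 0; 1; 4; 5]); (false, [:: 0; 1; 6; 7]);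
      (false, [:: 0; 2; 4; 6]); (true, [:: 0; 2; 5; 7]); (true, [:: 0; 3; 4; 7]);
      (true, [:: 0; 3; 5; 6]); (true, [:: 1; 2; 4; 7]); (true, [:: 1; 2; 5; 6]);
      (true, [:: 1; 3; 4; 6]); (false, [:: 1; 3; 5; 7]); (false, [:: 2; 3; 4; 5]);
      (false, [:: 2; 3; 6; 7]); (false, [:: 4; 5; 6; 7])]%N.

Lemma dx_idx_set s J : dx_ R [seq i.+1 | i <- s] J = (J == idx_set s)%:R.
Proof.
rewrite /dx_ /dxI ffunE; congr ((_ == _)%:R); apply/setP => i; rewrite !inE.
by rewrite mem_map //; exact: succn_inj.
Qed.

Lemma Omega0_coef J : Omega0 R J = coef Omega_list J.
Proof.
rewrite /coef /Omega_list; rewrite !big_cons big_nil /= -!dx_idx_set /=.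
by rewrite /Omega0 !ffunE !expr1 !expr0 !mul1r !mulN1r !addrA addr0.
Qed.

Definition Omega_star (V : lmodType R) (w : ext V) : ext V := star (wedge (Omega0 R) w).

(** The row of index k in the matrix of w |-> *(Omega0 /\ w): a term p of Omega0 disjoint from k
    contributes the component of w on the rest r of the complement of k. *)
Definition star_row (k : seq nat) : sform :=
  [seq (let r := list_diff (list_compl k) p.2 in
        (odd (inversions (list_compl k) k) (+) (p.1 (+) odd (inversions p.2 r)), r))
  | p <- Omega_list & list_sub p.2 (list_compl k)].

Lemma Omega_star_row (V : lmodType R) (w : ext V) k :
  Omega_star w (idx_set k) = contract (star_row k) w.
Proof.
rewrite /Omega_star /star ffunE (wedge_coef _ _ Omega0_coef) idx_setC.
rewrite shuffle_sign_idx_set scaler_sumr /contract /star_row big_map big_filter.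
rewrite [RHS]big_mkcond; apply: eq_bigr => p _.
rewrite idx_set_subset; case: ifP => _; last by rewrite scaler0.
rewrite idx_setD shuffle_sign_idx_set /= !scalerA !signr_addb mulrA.
by rewrite !signr_odd.
Qed.

Definition eta_list : seq sform :=
  [:: [:: (false, [:: 0; 1]); (false, [:: 2; 3]); (false, [:: 4; 5]); (false, [:: 6; 7])];
      [:: (false, [:: 0; 2]); (true, [:: 1; 3]); (false, [:: 4; 6]); (true, [:: 5; 7])];
      [:: (false, [:: 0; 3]); (false, [:: 1; 2]); (true, [:: 4; 7]); (true, [:: 5; 6])];
      [:: (false, [:: 0; 4]); (true, [:: 1; 5]); (true, [:: 2; 6]); (false, [:: 3; 7])];
      [:: (false, [:: 0; 5]); (false, [:: 1; 4]); (false, [:: 2; 7]); (false, [:: 3; 6])];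
      [:: (false, [:: 0; 6]); (true, [:: 1; 7]); (false, [:: 2; 4]); (true, [:: 3; 5])];
      [:: (false, [:: 0; 7]); (false, [:: 1; 6]); (true, [:: 2; 5]); (true, [:: 3; 4])]]%N.

Definition pair_list : seq (seq nat) :=
  flatten [seq [seq [:: i; j] | j <- iota i.+1 (7 - i)] | i <- iota 0 8]%N.

Lemma card2_idx_set (K : {set 'I_8}) : #|K| = 2%N ->
  exists2 k, k \in pair_list & K = idx_set k.
Proof.
move=> /eqP /cards2P[x [y [xy ->]]].
wlog lt_xy : x y xy / (x < y)%N.
  move=> H; have [/H|/H|/val_inj E] := ltngtP x y; [exact| |by rewrite E eqxx in xy].
  by rewrite eq_sym finset.setUC; apply.
exists [:: nat_of_ord x; nat_of_ord y].
  apply/flatten_mapP; exists (nat_of_ord x); first by rewrite mem_iota /= add0n.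
  apply/mapP; exists (nat_of_ord y) => //; rewrite mem_iota lt_xy /=.
  by rewrite addSn subnKC // -ltnS.
by apply/setP => i; rewrite !inE.
Qed.

Lemma card_idx_set_pair k : k \in pair_list -> #|idx_set k| = 2%N.
Proof.
move=> /flatten_mapP[i]; rewrite mem_iota /= add0n => i8 /mapP[j].
rewrite mem_iota => /andP[ij ji] ->.
have j8 : (j < 8)%N by move: ji; rewrite addSn subnKC.
have -> : idx_set [:: i; j] = [set Ordinal i8; Ordinal j8]%SET.
  by apply/setP => l; rewrite !inE.
by rewrite cards2 -val_eqE /= neq_ltn ij.
Qed.

(** Row k of the sum of eta (x) eta over the seven forms, kept as a signed list. *)
Definition eta_row (k : seq nat) : sform :=
  flatten [seq flatten [seq [seq (p.1 (+) q.1, q.2) | q <- l]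
                       | p <- l & list_eqset k p.2] | l <- eta_list].

Lemma coef_idx_set l k :
  coef l (idx_set k) = \sum_(p <- l | list_eqset k p.2) (-1) ^+ p.1.
Proof.
rewrite /coef [RHS]big_mkcond; apply: eq_bigr => p _.
by rewrite idx_set_eq; case: ifP; rewrite ?mulr1 ?mulr0.
Qed.

Lemma eta_row_contract (V : lmodType R) (w : ext V) k :
  \sum_(l <- eta_list) coef l (idx_set k) *: contract l w = contract (eta_row k) w.
Proof.
rewrite /contract /eta_row big_flatten big_map; apply: eq_bigr => l _.
rewrite coef_idx_set scaler_suml big_flatten big_map big_filter.
apply: eq_bigr => p _; rewrite big_map scaler_sumr; apply: eq_bigr => q _ /=.
by rewrite scalerA signr_addb.
Qed.

(** This is the matrix identity 1 + *(Omega0 /\ .) = sum of eta (x) eta, evaluated on all 28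
    rows. *)
Lemma eta_row_star_row k : k \in pair_list ->
  perm_eq ((false, k) :: star_row k) (eta_row k).
Proof.
by apply/allP: k; vm_compute.
Qed.

Lemma eta_pairs l p : l \in eta_list -> p \in l -> p.2 \in pair_list.
Proof.
move=> le; move: p; apply/allP; move: l le; apply/allP; by vm_compute.
Qed.

Lemma coef_eta_deg2 l (K : {set 'I_8}) : l \in eta_list -> #|K| != 2%N -> coef l K = 0.
Proof.
move=> le K2; rewrite /coef big1_seq // => p /= pl.
case: eqP => [E|_]; last by rewrite mulr0.
by rewrite E card_idx_set_pair ?eqxx // in K2; exact: eta_pairs pl.
Qed.

Lemma Omega_list_card p : p \in Omega_list -> #|idx_set p.2| = 4%N.
Proof.
have card_idx_set s : #|idx_set s| = count (mem s) (iota 0 8).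
  rewrite cardsE cardE size_filter -val_enum_ord count_map enumT.
  exact: eq_count.
move=> pO; rewrite card_idx_set; apply/eqP.
by move: p pO; apply/allP; vm_compute.
Qed.

Lemma Omega_star_deg2 (V : lmodType R) (w : ext V) :
  of_degree 2 w -> of_degree 2 (Omega_star w).
Proof.
move=> w2 K K2; rewrite /Omega_star /star ffunE (wedge_coef _ _ Omega0_coef).
rewrite big1_seq ?scaler0 // => p /= pO; case: ifP => // sub.
rewrite w2 ?scaler0 //; apply: contra K2 => /eqP E.
have := cardsID (idx_set p.2) (~: K)%SET.
rewrite E (finset.setIidPr sub) Omega_list_card // => C.
by have := cardsC K; rewrite -C card_ord => /(canRL (addnK _)) ->.
Qed.

(* The 28 coordinate 2-forms split into 7 blocks of 4; on each block
   w |-> *(Omega0 /\ w) is (rank one) - identity, so its 3-eigenspace is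
   spanned by the 7 forms eta. *)
Lemma Omega_star_eta (V : lmodType R) (w : ext V) K : of_degree 2 w ->
  w K + Omega_star w K = \sum_(l <- eta_list) coef l K *: contract l w.
Proof.
move=> w2; have [K2|K2] := eqVneq #|K| 2%N; last first.
  rewrite w2 // Omega_star_deg2 // add0r big1_seq // => l /= le.
  by rewrite coef_eta_deg2 // scale0r.
have [k kp ->] := card2_idx_set K2.
rewrite eta_row_contract Omega_star_row /contract -(perm_big _ (eta_row_star_row kp)).
by rewrite /= big_cons expr0 scale1r.
Qed.

(** Signs of the common terms of two forms, to be summed to their inner product. For distinct eta
    forms no term is common; for equal ones there are four positive signs. *)
Definition gram_list (l l' : sform) : seq bool :=
  flatten [seq [seq p.1 (+) q.1 | q <- l' & list_eqset p.2 q.2] | p <- l].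

Lemma gram_list_eta l l' : l \in eta_list -> l' \in eta_list ->
  gram_list l l' = if l == l' then nseq 4 false else [::].
Proof.
move=> le l'e; apply/eqP; move: l' l'e; apply/allP; move: l le; apply/allP.
by vm_compute.
Qed.

Lemma gram_eta l l' : l \in eta_list -> l' \in eta_list ->
  \sum_(p <- l) (-1) ^+ p.1 * coef l' (idx_set p.2) = 4%:R *+ (l == l').
Proof.
move=> le l'e.
transitivity (\sum_(b <- gram_list l l') (-1) ^+ b : R).
  rewrite big_flatten big_map; apply: eq_bigr => p _.
  rewrite coef_idx_set mulr_sumr big_map big_filter; apply: eq_bigr => q _.
  by rewrite signr_addb.
rewrite gram_list_eta //; case: eqP => _; last by rewrite big_nil.
by rewrite !big_cons big_nil expr0 /=; ring.
Qed.

(** Expansion in the orthogonal family eta; 4 is the squared norm of each member. *)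
Definition proj27 (V : lmodType R) (w : ext V) : ext V :=
  [ffun K => 4%:R^-1 *: \sum_(l <- eta_list) coef l K *: contract l w].

Lemma eta_uniq : uniq eta_list. Proof. by vm_compute. Qed.

Let four_neq0 : 4%:R != 0 :> R. Proof. by rewrite pnatr_eq0. Qed.

Lemma contract_proj27 (V : lmodType R) (w : ext V) l : l \in eta_list ->
  contract l (proj27 w) = contract l w.
Proof.
move=> le; rewrite [LHS]/contract.
under eq_bigr do rewrite ffunE scalerA mulrC -scalerA scaler_sumr.
rewrite -scaler_sumr exchange_big /= big_seq.
under eq_bigr => l' l'e.
  under eq_bigr do rewrite scalerA.
  rewrite -scaler_suml gram_eta //; over.
rewrite -big_seq (bigD1_seq l) ?eta_uniq //= eqxx big1 ?addr0 => [|l' /negPf l'l].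
  by rewrite scalerA mulVf // scale1r.
by rewrite eq_sym l'l scale0r.
Qed.

Lemma proj27_deg2 (V : lmodType R) (w : ext V) : of_degree 2 (proj27 w).
Proof.
move=> K K2; rewrite ffunE big1_seq ?scaler0 // => l /= le.
by rewrite coef_eta_deg2 // scale0r.
Qed.

(** On combinations of the eta forms, 1 + [Omega_star] is multiplication by their squared norm 4,
    which leaves the eigenvalue 3. *)
Lemma proj27_Lambda27 (V : lmodType R) (w : ext V) : Lambda27 (proj27 w).
Proof.
split; first exact: proj27_deg2.
apply/ffunP => K; rewrite [RHS]ffunE.
have := Omega_star_eta K (@proj27_deg2 _ w).
rewrite -[star _]/(Omega_star _) big_seq.
under eq_bigr do rewrite contract_proj27 //.
rewrite -big_seq; set S := \sum_(l <- _) _ => E.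
have SE : S = 4%:R *: proj27 w K by rewrite ffunE scalerA mulfV // scale1r.
apply: (@addrI _ (proj27 w K)); rewrite E SE -[X in X + _]scale1r -scalerDl.
by congr (_ *: _); ring.
Qed.

Lemma Lambda27_proj27 (V : lmodType R) (w : ext V) : Lambda27 w -> proj27 w = w.
Proof.
move=> [w2 Tw]; apply/ffunP => K; rewrite ffunE -Omega_star_eta // /Omega_star Tw.
rewrite ffunE -[X in X + _]scale1r -scalerDl scalerA.
have -> : 4%:R^-1 * (1 + 3%:R) = 1 :> R by field.
by rewrite scale1r.
Qed.

Lemma pairing_coef (V : lmodType R) l (w : ext V) (z : ext R) :
  (forall J, z J = coef l J) -> pairing z w = contract l w.
Proof. by move=> zl; rewrite /pairing; under eq_bigr do rewrite zl; exact: sum_coef. Qed.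

Lemma contractB (V : lmodType R) l (w w' : ext V) :
  contract l (w - w') = contract l w - contract l w'.
Proof.
by rewrite /contract -sumrB; apply: eq_bigr => p _; rewrite !ffunE scalerBr.
Qed.

Definition eta_form (l : sform) : ext R := [ffun J => coef l J].

Lemma eta_form_Lambda27 l : l \in eta_list -> Lambda27 (eta_form l : ext R^o).
Proof.
move=> le.
suff -> : (eta_form l : ext R^o) = proj27 (eta_form l : ext R^o).
  exact: proj27_Lambda27.
apply/ffunP => K; rewrite [RHS]ffunE.
rewrite (bigD1_seq l) ?eta_uniq //= big1_seq => [|l' /andP[/negPf l'l l'e]].
  rewrite addr0 /contract.
  under eq_bigr do rewrite ffunE.
  rewrite (gram_eta le le) eqxx ffunE.
  rewrite -[RHS]/(4%:R^-1 * (coef l K * 4%:R)).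
  by rewrite mulrC mulfK.
rewrite /contract; under eq_bigr do rewrite ffunE.
by rewrite (gram_eta l'e le) l'l scaler0.
Qed.

Lemma proj27_orth (V : lmodType R) (w : ext V) :
  of_degree 2 w -> is_orthproj27 w (proj27 w).
Proof.
move=> w2; split; first exact: proj27_Lambda27.
move=> z z7; rewrite /pairing.
have zE I : z I = 4%:R^-1 * \sum_(l <- eta_list) coef l I * contract l (z : ext R^o).
  by rewrite -{1}(Lambda27_proj27 z7) ffunE.
under eq_bigr do rewrite zE -scalerA scaler_suml.
rewrite -scaler_sumr exchange_big /= big1_seq ?scaler0 // => l /= le.
under eq_bigr do rewrite mulrC -scalerA.
rewrite -scaler_sumr sum_coef -/(contract l _) contractB contract_proj27 //.
by rewrite subrr scaler0.
Qed.

(** [pi27] is a choice, so uniqueness is the content: an element of Lambda^2_7 is determined by its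
    contractions with the eta forms, and orthogonality prescribes these. *)
Lemma pi27E (V : lmodType R) (w : ext V) : of_degree 2 w -> pi27 w = proj27 w.
Proof.
move=> w2; apply: xget_unique; first exact: proj27_orth.
move=> p [p7 po]; rewrite -(Lambda27_proj27 p7).
apply/ffunP => K; rewrite !ffunE; congr (_ *: _).
apply: eq_big_seq => l le; congr (_ *: _); apply/esym/eqP.
rewrite -subr_eq0 -contractB; apply/eqP.
rewrite -(@pairing_coef _ _ _ (eta_form l)); last by move=> J; rewrite ffunE.
exact/po/eta_form_Lambda27.
Qed.

End FormAlgebra.

(** * Exterior derivative, pullback and the orbifold group *)

Section ExteriorDerivative.
Variables (R : realType) (V : normedModType R).
Notation R8 := 'rV[R]_8.
Local Notation e := (@e R).
Implicit Types (w : R8 -> ext V) (K : {set 'I_8}).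

Lemma extdE w x K : extd w x K = \sum_(i in K)
  shuffle_sign R [set i]%SET (K :\ i)%SET *: pd i (fun y => w y (K :\ i)%SET) x.
Proof.
rewrite /extd sum_ffunE [RHS]big_mkcond; apply: eq_bigr => i _.
rewrite /wedge ffunE big_mkcond (bigD1 [set i]%SET) //= big1 => [|I /negPf Ii].
  rewrite addr0 finset.sub1set /dxI !ffunE eqxx mulr1; case: ifP => // iK.
by rewrite /dxI ffunE Ii mulr0 scale0r; case: ifP.
Qed.

Lemma shuffle_sign1 (i : 'I_8) (J : {set 'I_8}) :
  shuffle_sign R [set i]%SET J = (-1) ^+ #|[set j in J | (j < i)%N]%SET|.
Proof.
rewrite /shuffle_sign; congr (_ ^+ _).
rewrite -(card_imset (mem [set j in J | (j < i)%N]%SET) (f := pair i)); last first.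
  by move=> a b [].
apply: eq_card => -[a b]; rewrite !inE /=; apply/and3P/imsetP => /=.
  by move=> [/eqP -> bJ bi]; exists b => //; rewrite !inE bJ.
by move=> [c]; rewrite !inE => /andP[cJ ci] [-> ->]; rewrite eqxx.
Qed.

Lemma extd_degree w x k : (forall y, of_degree k (w y)) -> of_degree k.+1 (extd w x).
Proof.
move=> wk K Kk; rewrite extdE big1 // => i iK.
have -> : (fun y => w y (K :\ i)%SET) = fun=> 0.
  apply/funext => y; apply: wk; apply: contra Kk => /eqP <-.
  by rewrite (cardsD1 i K) iK.
by rewrite pd_cst scaler0.
Qed.

Lemma extd_1 w x i : extd w x [set i]%SET = pd i (fun y => w y finset.set0) x.
Proof.
rewrite extdE big_set1 finset.setDv shuffle_sign1.
rewrite (_ : [set j in finset.set0 | _]%SET = finset.set0); last first.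
  by apply/setP => j; rewrite !inE.
by rewrite cards0 expr0 scale1r.
Qed.

Lemma extd_2 w x (i j : 'I_8) : (i < j)%N -> extd w x [set i; j]%SET =
  pd i (fun y => w y [set j]%SET) x - pd j (fun y => w y [set i]%SET) x.
Proof.
move=> ij; have ij' : i != j by rewrite -val_eqE /= neq_ltn ij.
rewrite extdE big_setU1 ?inE //= big_set1.
have -> : ([set i; j] :\ i)%SET = [set j]%SET.
  apply/setP => l; rewrite !inE; case: eqP => //= ->.
  by rewrite (negPf ij').
have -> : ([set i; j] :\ j)%SET = [set i]%SET.
  apply/setP => l; rewrite !inE; case: (eqVneq l j) => //= [->|_].
    by rewrite eq_sym (negPf ij').
  by rewrite orbF.
rewrite !shuffle_sign1.
have -> : [set l in [set j] | (l < i)%N]%SET = finset.set0.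
  by apply/setP => l; rewrite !inE; case: eqP => //= ->; rewrite ltnNge ltnW.
have -> : [set l in [set i] | (l < j)%N]%SET = [set i]%SET.
  by apply/setP => l; rewrite !inE; case: eqP => //= ->.
by rewrite cards0 cards1 expr0 expr1 scale1r scaleN1r.
Qed.

End ExteriorDerivative.

Section Pullback.
Variables (R : realType) (s b : seq R).
Notation R8 := 'rV[R]_8.
Local Notation e := (@e R).
Local Notation g := (diag_affine s b).

Lemma derive_diag_affine x i : 'D_(e i) g x = s`_i *: e i.
Proof.
have did (y : R8) : differentiable (id : R8 -> R8) y by [].
have H := congr1 (fun h => h x) (pd_diag_affine s b i did).
by rewrite /pd derive_id in H.
Qed.

Lemma pull_dx_diag x i : pull_dx g x i = s`_i *: (dxI R [set i]%SET : ext R^o).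
Proof.
rewrite /pull_dx (bigD1 i) //= big1 ?addr0 => [|j /negPf ji].
  by rewrite derive_diag_affine !mxE !eqxx mulr1.
by rewrite derive_diag_affine !mxE eq_sym ji mulr0 scale0r.
Qed.

Lemma wedge_dx_dxI (c c' : R) (i : 'I_8) (J : {set 'I_8}) : i \notin J ->
  (forall j, j \in J -> (i < j)%N) ->
  wedge (c *: (dxI R [set i]%SET : ext R^o) : ext R)
        (c' *: (dxI R J : ext R^o) : ext R^o)
  = c * c' *: (dxI R (i |: J)%SET : ext R^o).
Proof.
move=> iJ lt_iJ; apply/ffunP => K; rewrite !ffunE big_mkcond (bigD1 [set i]%SET) //=.
rewrite big1 ?addr0 => [|I /negPf Ii]; last first.
  by rewrite !ffunE Ii scaler0 mulr0 scale0r; case: ifP.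
rewrite finset.sub1set !ffunE eqxx.
have [iK|iK] := boolP (i \in K); last first.
  have -> : (K == i |: J)%SET = false.
    by apply: contraNF iK => /eqP ->; rewrite !inE eqxx.
  by rewrite scaler0.
have [KJ|KJ] := eqVneq (K :\ i)%SET J.
  rewrite -KJ finset.setD1K // eqxx KJ shuffle_sign1.
  have -> : [set j in J | (j < i)%N]%SET = finset.set0.
    by apply/setP => j; rewrite !inE; apply/andP => -[/lt_iJ /ltnW]; rewrite leqNgt => /negPf ->.
  rewrite cards0 expr0 mul1r.
  by rewrite -[LHS]/(c * 1 * (c' * 1)) -[RHS]/(c * c' * 1) !mulr1.
have -> : (K == i |: J)%SET = false.
  by apply: contraNF KJ => /eqP ->; rewrite finset.setU1K.
by rewrite !scaler0.
Qed.

Lemma pull_dxI_diag x I :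
  pull_dxI g x I = (\prod_(i in I) s`_i) *: (dxI R I : ext R^o).
Proof.
have srt : sorted (fun i j : 'I_8 => (i < j)%N) (enum I).
  rewrite /enum_mem; apply: sorted_filter; first by move=> ? ? ?; exact: ltn_trans.
  have := iota_ltn_sorted 0 8; rewrite -val_enum_ord sorted_map.
  by rewrite enumT.
(* Sortedness is kept in the induction because it makes every shuffle sign trivial. *)
suff gen l : sorted (fun i j : 'I_8 => (i < j)%N) l ->
    foldr (fun i (a : ext R^o) => wedge (pull_dx g x i) a) (dxI R finset.set0) l
    = (\prod_(i <- l) s`_i) *: (dxI R [set j in l]%SET : ext R^o).
  by rewrite /pull_dxI gen // big_enum finset.set_enum.
elim: l => [|i l IH] srtl /=.
  by rewrite big_nil scale1r (_ : [set j in [::]]%SET = finset.set0).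
rewrite IH; last exact: path_sorted srtl.
have il j : j \in l -> (i < j)%N.
  by have /allP H := order_path_min (fun y x z : 'I_8 => @ltn_trans y x z) srtl; move/H.
rewrite pull_dx_diag big_cons wedge_dx_dxI.
- by congr (_ *: dxI R _); apply/setP => j; rewrite !inE.
- by rewrite inE; apply/negP => /il; rewrite ltnn.
- by move=> j; rewrite inE => /il.
Qed.

Lemma pullback_diag (V : lmodType R) (w : R8 -> ext V) x J :
  pullback g w x J = (\prod_(i in J) s`_i) *: w (g x) J.
Proof.
rewrite /pullback ffunE (bigD1 J) //= big1 ?addr0 => [|I /negPf IJ].
  by rewrite pull_dxI_diag /dxI !ffunE eqxx [_ *: 1]mulr1.
by rewrite pull_dxI_diag /dxI !ffunE eq_sym IJ [_ *: 0]mulr0 scale0r.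
Qed.

End Pullback.

(** * The orbifold group and its representation *)

Section Group.
Variable R : realType.
Notation R8 := 'rV[R]_8.
Local Notation e := (@e R).
Implicit Types (g h : R8 -> R8).

Definition signs (s : seq R) := forall i : 'I_8, s`_i = 1 \/ s`_i = -1.

Lemma tau_e (k : 'I_8) (x : R8) : tau k.+1 x = x + e k.
Proof. by apply/rowP => i; rewrite !mxE eqxx eqSS. Qed.

Lemma tau_diag n : (tau n : R8 -> R8) =
  diag_affine (nseq 8 1) [seq (i.+1 == n)%:R | i <- iota 0 8].
Proof.
apply/funext => x; apply/rowP => i; rewrite !mxE nth_nseq ltn_ord mul1r.
by rewrite (nth_map 0%N) ?size_iota // nth_iota.
Qed.

Lemma signs_mul (s : seq R) (i : 'I_8) : signs s -> s`_i * s`_i = 1.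
Proof. by move=> /(_ i)[] ->; rewrite ?mulrNN mulr1. Qed.

Lemma signsP (s : seq R) : size s = 8%N ->
  all (fun a => (a == 1) || (a == -1)) s -> signs s.
Proof.
move=> s8 /(all_nthP 0) H i; have := H i; rewrite s8 ltn_ord => /(_ isT).
by case/orP => /eqP ->; [left | right].
Qed.

Lemma nth_fun8 (F : nat -> R) (i : 'I_8) : [seq F j | j <- iota 0 8]`_i = F i.
Proof. by rewrite (nth_map 0%N) ?size_iota // nth_iota. Qed.

(** Maps of this shape are closed under composition and inversion; the inverse has the same signs
    and translation part - s b. *)
Lemma pi1orb_diag g : pi1orb g -> exists s b, signs s /\ g = diag_affine s b.
Proof.
elim=> {g} [||||n _||g h _ [s [b [ss ->]]] _ [t [c [st ->]]]|g h _ [s [b [ss ->]]] _ hK].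
- by do 2 eexists; split; last reflexivity; apply: signsP; rewrite //= !eqxx ?orbT.
- by do 2 eexists; split; last reflexivity; apply: signsP; rewrite //= !eqxx ?orbT.
- by do 2 eexists; split; last reflexivity; apply: signsP; rewrite //= !eqxx ?orbT.
- by do 2 eexists; split; last reflexivity; apply: signsP; rewrite //= !eqxx ?orbT.
- rewrite tau_diag; do 2 eexists; split; last reflexivity.
  by move=> i; rewrite nth_nseq ltn_ord; left.
- exists (nseq 8 1), (nseq 8 0); split.
    by move=> i; rewrite nth_nseq ltn_ord; left.
  by apply/funext => x; apply/rowP => i; rewrite !mxE !nth_nseq ltn_ord mul1r addr0.
- exists [seq s`_i * t`_i | i <- iota 0 8], [seq s`_i * c`_i + b`_i | i <- iota 0 8].
  split.
    move=> i; rewrite nth_fun8.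
    by case: (ss i) (st i) => -> [] ->; rewrite ?mulrNN !(mulr1, mul1r);
       (by left) || (by right).
  apply/funext => x; apply/rowP => i; rewrite [RHS]mxE !nth_fun8 /= !mxE; ring.
- exists s, [seq - (s`_i * b`_i) | i <- iota 0 8]; split=> //.
  apply/funext => x; apply/rowP => i.
  rewrite [RHS]mxE nth_fun8.
  have := congr1 (fun y : R8 => y 0 i) (hK x); rewrite mxE => <-.
  by rewrite mulrDr mulrA signs_mul // mul1r addrK.
Qed.

Section Representation.
Variable rho : (R8 -> R8) -> 'M[R]_8.
Hypothesis rho_rep : is_rep rho.
Hypothesis rho_alpha : rho (@alpha R) = 1%:M.
Hypothesis rho_beta : rho (@beta R) = 1%:M.

Lemma rho_orth g : pi1orb g -> rho g *m (rho g)^T = 1%:M.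
Proof. by move=> /rho_rep.1[]. Qed.

Lemma rho_inv g : pi1orb g -> invmx (rho g) = (rho g)^T.
Proof.
move=> gG; have o := rho_orth gG; have [u _] := mulmx1_unit o.
by rewrite -[RHS]mul1mx -(mulVmx u) -mulmxA o mulmx1.
Qed.

Lemma rho_id : rho id = 1%:M.
Proof.
have o := rho_orth (@pi1_id R).
have := rho_rep.2 id id (@pi1_id R) (@pi1_id R) => /(congr1 (mulmx^~ (rho id)^T)).
by rewrite /= o -mulmxA o mulmx1 => /esym.
Qed.

Lemma rho_tau_sq (k : 'I_8) : rho (tau k.+1) *m rho (tau k.+1) = 1%:M.
Proof.
have kG : pi1orb (@tau R k.+1) by apply: pi1_tau; rewrite ltn_ord.
have sq (a : R8 -> R8) : pi1orb a -> rho a = 1%:M ->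
    a \o (tau k.+1 \o (a \o tau k.+1)) = id ->
    rho (tau k.+1) *m rho (tau k.+1) = 1%:M.
  move=> aG a1 /(congr1 rho).
  have t1 := pi1_comp aG kG; have t2 := pi1_comp kG t1.
  rewrite (rho_rep.2 _ _ aG t2) (rho_rep.2 _ _ kG t1) (rho_rep.2 _ _ aG kG).
  by rewrite a1 !mul1mx rho_id.
have [k4|k4] := ltnP k 4.
  apply: (sq _ (@pi1_alpha R) rho_alpha); apply/funext => x; apply/rowP => i.
  rewrite /= !mxE; case: (eqVneq (i : nat) (k : nat)) => [->|/negPf ki].
    rewrite eqxx; move: k4; case: (nat_of_ord k) => [|[|[|[|]]]] //= _; ring.
  rewrite eqSS ki; case: i {ki} => -[|[|[|[|[|[|[|[|]]]]]]]] //= ?; ring.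
apply: (sq _ (@pi1_beta R) rho_beta); apply/funext => x; apply/rowP => i.
rewrite /= !mxE; case: (eqVneq (i : nat) (k : nat)) => [->|/negPf ki].
  rewrite eqxx; move: k4 (ltn_ord k).
  case: (nat_of_ord k) => [|[|[|[|[|[|[|[|]]]]]]]] //= _ _; ring.
rewrite eqSS ki; case: i {ki} => -[|[|[|[|[|[|[|[|]]]]]]]] //= ?; ring.
Qed.

Lemma rho_tau_sym (k : 'I_8) : (rho (tau k.+1))^T = rho (tau k.+1).
Proof.
have kG : pi1orb (@tau R k.+1) by apply: pi1_tau; rewrite ltn_ord.
by rewrite -[LHS]mul1mx -(rho_tau_sq k) -mulmxA rho_orth // mulmx1.
Qed.

Lemma rho_tau_comm g (k : 'I_8) : pi1orb g ->
  rho g *m rho (tau k.+1) = rho (tau k.+1) *m rho g.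
Proof.
move=> gG; have kG : pi1orb (@tau R k.+1) by apply: pi1_tau; rewrite ltn_ord.
have [s [b [ss gE]]] := pi1orb_diag gG.
have [sk|sk] := ss k.
  rewrite -(rho_rep.2 _ _ gG kG) -(rho_rep.2 _ _ kG gG); congr rho.
  apply/funext => x /=.
  rewrite !tau_e gE addrC -[e k]scale1r diag_affine_shift sk !scale1r.
  by rewrite addrC.
(* When g reverses direction k the two translations cancel; as T_k squares to 1, the resulting
   relation is again commutation. *)
have : tau k.+1 \o (g \o tau k.+1) = g.
  apply/funext => x /=; rewrite !tau_e gE [x + _]addrC -[e k]scale1r.
  by rewrite diag_affine_shift sk !scaleN1r !scale1r addrAC addNr add0r.
move=> /(congr1 rho).
rewrite (rho_rep.2 _ _ kG (pi1_comp gG kG)) (rho_rep.2 _ _ gG kG).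
move=> /(congr1 (mulmx (rho (tau k.+1)))); rewrite mulmxA rho_tau_sq mul1mx.
by [].
Qed.

End Representation.
End Group.

(** * Second-order identities *)

Section SecondOrderTerms.
Variable R : realType.
Notation R8 := 'rV[R]_8.
Local Notation o n := (inord n : 'I_8).

(* (b, (p, (q, n))) stands for the term (-1)^b d_p d_q f_n. *)
Definition term := (nat * (nat * nat))%type.
(** Normal form modulo the commutation of mixed partial derivatives. *)
Definition sorted_term (t : term) : term :=
  if (t.1 <= t.2.1)%N then t else (t.2.1, (t.1, t.2.2)).
Definition pos_terms (L : seq (bool * term)) := [seq t.2 | t <- L & ~~ t.1].
Definition neg_terms (L : seq (bool * term)) := [seq t.2 | t <- L & t.1].

(** Moving negative terms to the other side turns a cancellation into an equality of multisets,
    which [perm_eq] decides by evaluation. *)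
Lemma signed_sum (V : lmodType R) (f : term -> V) L M :
  (forall t, f (sorted_term t) = f t) ->
  perm_eq (map sorted_term (pos_terms L)) (map sorted_term (neg_terms L ++ M)) ->
  \sum_(t <- L) (-1) ^+ t.1 *: f t.2 = \sum_(t <- M) f t.
Proof.
move=> fs LM.
have sE N : \sum_(t <- N) f t = \sum_(t <- map sorted_term N) f t.
  by rewrite big_map; apply: eq_bigr.
have : \sum_(t <- pos_terms L) f t = \sum_(t <- neg_terms L ++ M) f t.
  by rewrite sE (perm_big _ LM) -sE.
rewrite big_cat /pos_terms /neg_terms !big_map !big_filter => E.
rewrite (bigID (fun t => ~~ t.1)) /=.
rewrite (eq_bigr (fun t => f t.2)) => [|t /negPf ->]; last by rewrite scale1r.
rewrite E addrAC -[RHS]add0r; congr (_ + _).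
under [X in _ + X]eq_bigl do rewrite negbK.
rewrite -big_split big1 // => t /= ->.
by rewrite expr1 scaleN1r subrr.
Qed.

Definition eta_ n := nth [::] eta_list n.
Definition fst_ (p : bool * seq nat) := nth 0%N p.2 0.
Definition snd_ (p : bool * seq nat) := nth 0%N p.2 1.
(** The comparison ignores the order of the pair, so the orientation sign is added separately, as (i
    < q) in [rigid_terms] and (j < m) in [potential_terms]. *)
Definition eta_sign n (k : seq nat) := [seq p.1 | p <- eta_ n & list_eqset k p.2].

Lemma eta_mem n : (n < 7)%N -> eta_ n \in eta_list.
Proof. by move=> n7; rewrite mem_nth. Qed.

Lemma eta_elem n p : (n < 7)%N -> p \in eta_ n ->
  [/\ (fst_ p < snd_ p)%N, (snd_ p < 8)%N & p.2 = [:: fst_ p; snd_ p]].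
Proof.
move=> /eta_mem; set l := eta_ n => le pl.
suff /and3P[? ? /eqP] : [&& fst_ p < snd_ p, snd_ p < 8 & p.2 == [:: fst_ p; snd_ p]]%N.
  by [].
by move: p pl; apply/allP; move: {n} l le; apply/allP; vm_compute.
Qed.

Lemma eta_sign_diag n j : (n < 7)%N -> (j < 8)%N -> eta_sign n [:: j; j] = [::].
Proof.
move=> n7 j8; have nI : n \in iota 0 7 by rewrite mem_iota.
have jI : j \in iota 0 8 by rewrite mem_iota.
apply/eqP; move: {n7} n nI {j8}; apply/allP; move: j jI; apply/allP.
by vm_compute.
Qed.

Lemma coef_eta_sign n k : coef R (eta_ n) (idx_set k) = \sum_(c <- eta_sign n k) (-1) ^+ c.
Proof. by rewrite coef_idx_set /eta_sign big_map big_filter. Qed.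

Lemma idx_set2 n m : (n < 8)%N -> (m < 8)%N -> idx_set [:: n; m] = [set o n; o m]%SET.
Proof.
by move=> n8 m8; apply/setP => i; rewrite !inE -!val_eqE /= !inordK.
Qed.

Section Contract.
Variable V : normedModType R.

Lemma contract_extd n (a : R8 -> ext V) x : (n < 7)%N ->
  contract (eta_ n) (extd a x) = \sum_(p <- eta_ n) (-1) ^+ p.1 *:
   (pd (o (fst_ p)) (fun y => a y [set o (snd_ p)]%SET) x
    - pd (o (snd_ p)) (fun y => a y [set o (fst_ p)]%SET) x).
Proof.
move=> n7; apply: eq_big_seq => p pn; have [lt12 lt28 ->] := eta_elem n7 pn.
have lt18 := ltn_trans lt12 lt28.
by rewrite idx_set2 // extd_2 // !inordK.
Qed.

End Contract.

(* d_q <eta_n, d a> in terms of the d_p d_q a_m *)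
Definition dcontract_terms n q : seq (bool * term) :=
  flatten [seq [:: (p.1, (q, (fst_ p, snd_ p))); (~~ p.1, (q, (snd_ p, fst_ p)))]
          | p <- eta_ n].

(* sum_(q, n) +- d_q <eta_n, d a>, which is Delta a_i - d_i (div a) *)
Definition rigid_terms i : seq (bool * term) :=
  flatten [seq flatten [seq flatten [seq
     [seq (c (+) (i < q)%N (+) t.1, t.2) | t <- dcontract_terms n q]
     | c <- eta_sign n [:: q; i]] | n <- iota 0 7] | q <- iota 0 8].

(** On symbols: |xi|^2 a is the sum of its components along the orthogonal vectors xi and J_n xi.
    The terms appended to [L] are the component along xi, that is d_i (div a). *)
Lemma rigid_terms_perm i : (i < 8)%N ->
  let L := rigid_terms i ++ [seq (false, (i, (p, p))) | p <- iota 0 8] in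
  perm_eq (map sorted_term (pos_terms L))
    (map sorted_term (neg_terms L ++ [seq (p, (p, i)) | p <- iota 0 8])).
Proof.
move=> i8; have : i \in iota 0 8 by rewrite mem_iota.
by move: {i8} i; apply/allP; vm_compute.
Qed.

(* a_j = sum_m +- d_m V_{mj} for V in Lambda^2_7, V_{mj} = sum_n coef eta_n y_n *)
Definition potential_terms j : seq (bool * (nat * nat)) :=
  flatten [seq flatten [seq [seq ((j < m)%N (+) c, (m, n)) | c <- eta_sign n [:: m; j]]
     | n <- iota 0 7] | m <- iota 0 8].

Definition surjective_terms n : seq (bool * term) :=
  flatten [seq [seq (p.1 (+) t.1, (fst_ p, t.2)) | t <- potential_terms (snd_ p)]
            ++ [seq (~~ p.1 (+) t.1, (snd_ p, t.2)) | t <- potential_terms (fst_ p)]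
          | p <- eta_ n].

(** On symbols: J_n xi and J_m xi are orthogonal for n != m and have length |xi|, so only the
    Laplacian of y_n survives. *)
Lemma surjective_terms_perm n : (n < 7)%N ->
  perm_eq (map sorted_term (pos_terms (surjective_terms n)))
    (map sorted_term (neg_terms (surjective_terms n)
      ++ [seq (p, (p, n)) | p <- iota 0 8])).
Proof.
move=> n7; have : n \in iota 0 7 by rewrite mem_iota.
by move: {n7} n; apply/allP; vm_compute.
Qed.

Lemma sum_iota8 (V : nmodType) (F : nat -> V) :
  \sum_(p <- iota 0 8) F p = \sum_(p < 8) F p.
Proof. by rewrite -[iota 0 8]/(index_iota 0 8) big_mkord. Qed.

Definition second (f : nat -> R8 -> 'M[R]_8) x (t : term) : 'M[R]_8 :=
  pd (o t.1) (pd (o t.2.1) (f t.2.2)) x.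

Lemma second_sorted (f : nat -> R8 -> 'M[R]_8) x t :
  (forall n, smooth (f n)) -> (forall n, periodic2 (f n)) ->
  second f x (sorted_term t) = second f x t.
Proof.
move=> sf pf; case: t => p [q n]; rewrite /sorted_term /=; case: ifP => [//|_].
rewrite /second /=.
exact: (congr1 (fun h => h x) (pdC (o q) (o p) (sf n) (pf n))).
Qed.

Lemma sum_second_laplacian (f : nat -> R8 -> 'M[R]_8) n x :
  \sum_(t <- [seq (p, (p, n)) | p <- iota 0 8]) second f x t = laplacian (f n) x.
Proof.
rewrite big_map sum_iota8; apply: eq_bigr => p _.
by rewrite /second /= inord_val.
Qed.

Lemma rigid_identity (a : R8 -> ext 'M[R]_8) :
  (forall i : 'I_8, smooth (fun x => a x [set i]%SET)) ->
  (forall i : 'I_8, periodic2 (fun x => a x [set i]%SET)) ->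
  (forall n x, (n < 7)%N -> contract (eta_ n) (extd a x) = 0) ->
  forall (i : 'I_8) x, laplacian (fun y => a y [set i]%SET) x =
    \sum_p pd i (pd p (fun y => a y [set p]%SET)) x.
Proof.
move=> sa pa ca i x; pose f (n : nat) : R8 -> 'M[R]_8 := fun y => a y [set o n]%SET.
have sf n : smooth (f n) by exact: sa.
have pf n : periodic2 (f n) by exact: pa.
(* The first-order equation holds at every point, so it may be differentiated along q and
   expanded. *)
have dc n q : (n < 7)%N ->
    \sum_(t <- dcontract_terms n q) (-1) ^+ t.1 *: second f x t.2 = 0.
  move=> n7; pose G (p : bool * seq nat) : R8 -> 'M[R]_8 := fun y =>
    (-1) ^+ p.1 *:
    (pd (o (fst_ p)) (f (snd_ p)) y - pd (o (snd_ p)) (f (fst_ p)) y).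
  have sd p m : smooth (pd (o p) (f m)) by exact: smooth_pd.
  have sG p : smooth (G p) by apply: smoothZ; exact: smoothB.
  have G0 : (fun y => \sum_(p <- eta_ n) G p y) = fun=> 0.
    by apply/funext => y; rewrite -(contract_extd a y n7) ca.
  have := @iter_partial_sum R _ _ (eta_ n) xpredT G (fun p _ => sG p) [:: o q].
  rewrite G0 iter_partial0 => /(congr1 (fun h => h x)) /esym E.
  rewrite -[RHS]E big_flatten big_map; apply: eq_bigr => p _.
  have -> : iter_partial [:: o q] (G p) x = (-1) ^+ p.1 *:
      (pd (o q) (pd (o (fst_ p)) (f (snd_ p))) x
       - pd (o q) (pd (o (snd_ p)) (f (fst_ p))) x).
    rewrite iter_partialZ; last exact: smoothB.
    by rewrite iter_partialB.
  by rewrite big_cons big_seq1 /= signrN scaleNr -scalerBr.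
have rigid0 : \sum_(t <- rigid_terms i) (-1) ^+ t.1 *: second f x t.2 = 0.
  rewrite big_flatten big_map big1_seq // => q _.
  rewrite big_flatten big_map big1_seq // => n; rewrite mem_iota => /= n7.
  rewrite big_flatten big_map big1 // => c _; rewrite big_map.
  under eq_bigr do rewrite /= signr_addb -scalerA.
  by rewrite -scaler_sumr dc // scaler0.
have := signed_sum (fun t => second_sorted x t sf pf) (rigid_terms_perm (ltn_ord i)).
rewrite sum_second_laplacian /f inord_val => <-.
rewrite big_cat rigid0; apply: etrans (add0r _) _.
rewrite big_map sum_iota8; apply: eq_bigr => p _.
by rewrite expr0 scale1r /second /= !inord_val.
Qed.

Lemma surjective_identity (a : R8 -> ext 'M[R]_8) (y : nat -> R8 -> 'M[R]_8) :
  (forall n, smooth (y n)) -> (forall n, periodic2 (y n)) ->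
  (forall j x, (j < 8)%N -> a x [set o j]%SET =
     \sum_(t <- potential_terms j) (-1) ^+ t.1 *: pd (o t.2.1) (y t.2.2) x) ->
  forall n x, (n < 7)%N -> contract (eta_ n) (extd a x) = laplacian (y n) x.
Proof.
move=> sy py aE n x n7; rewrite contract_extd // -sum_second_laplacian.
have da i j : (j < 8)%N -> pd (o i) (fun z => a z [set o j]%SET) x =
    \sum_(t <- potential_terms j) (-1) ^+ t.1 *: second y x (i, t.2).
  move=> j8.
  have -> : (fun z => a z [set o j]%SET) = fun z =>
     \sum_(t <- potential_terms j) (-1) ^+ t.1 *: pd (o t.2.1) (y t.2.2) z.
    by apply/funext => z; exact: aE.
  have sd p m : smooth (pd (o p) (y m)) by exact: smooth_pd.
  rewrite -[pd (o i)]/(iter_partial [:: o i]) iter_partial_sum; last first.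
    by move=> t _; exact: smoothZ.
  by apply: eq_bigr => t _; rewrite iter_partialZ.
rewrite -(signed_sum (fun t => second_sorted x t sy py) (surjective_terms_perm n7)).
rewrite big_flatten big_map; apply: eq_big_seq => p pn.
have [lt12 lt28 _] := eta_elem n7 pn.
rewrite !da //; last exact: ltn_trans lt28.
move: (second y x) (potential_terms _) (potential_terms _) => h A B.
rewrite big_cat scalerBr !scaler_sumr -sumrN.
apply: (congr2 +%R).
  by rewrite big_map; apply: eq_bigr => t _; rewrite scalerA -signr_addb.
rewrite big_map; apply: eq_bigr => t _.
by rewrite scalerA signr_addb signrN mulNr scaleNr.
Qed.

End SecondOrderTerms.

(** * The deformation complex *)

Section Cohomology.
Variable R : realType.
Notation R8 := 'rV[R]_8.
Local Notation e := (@e R).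
Local Notation o n := (inord n : 'I_8).
Variable rho : (R8 -> R8) -> 'M[R]_8.
Hypothesis rho_rep : is_rep rho.
Hypothesis rho_alpha : rho (@alpha R) = 1%:M.
Hypothesis rho_beta : rho (@beta R) = 1%:M.

(** Keyed by the 0-based directions 3, 4, 7 of tau_4, tau_5, tau_8, with [true] for -1; the last
    branch serves 7 and any other index. *)
Definition tau_signs (k : nat) : seq bool :=
  if k == 3%N then [:: true; true; true; true; false; false; false; false]
  else if k == 4%N then [:: true; true; false; false; true; true; false; false]
  else [:: false; true; true; false; false; true; true; false].

Definition tau_diag_row (k : 'I_8) : 'rV[R]_8 :=
  \row_i [seq (-1) ^+ (c : bool) | c <- tau_signs k]`_i.

Definition tau_indices : {pred 'I_8} := [pred k : 'I_8 | nat_of_ord k \in [:: 3; 4; 7]%N].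

Definition twist (k : 'I_8) := rho (@tau R k.+1).

Lemma tau_diag_row_sep (i j : 'I_8) : i != j ->
  exists2 k, k \in tau_indices & tau_diag_row k 0 i * tau_diag_row k 0 j = -1.
Proof.
have size_signs k : size (tau_signs k) = 8%N.
  by rewrite /tau_signs; case: eqP => // _; case: eqP.
have E (k l : 'I_8) : tau_diag_row k 0 l = (-1) ^+ nth false (tau_signs k) l.
  by rewrite mxE (nth_map false) // size_signs.
move=> ij; suff /hasP[k kS kij] : has (fun k =>
    nth false (tau_signs k) i (+) nth false (tau_signs k) j) [:: 3; 4; 7]%N.
  have k8 : (k < 8)%N by move: kS; rewrite !inE => /or3P[] /eqP ->.
  exists (Ordinal k8); first by rewrite inE.
  by rewrite !E -signr_addb /= kij expr1.
have : all (fun i => all (fun j => (i != j) ==> has (fun k =>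
    nth false (tau_signs k) i (+) nth false (tau_signs k) j) [:: 3; 4; 7]%N)
  (iota 0 8)) (iota 0 8) by vm_compute.
move=> /allP /(_ i); rewrite mem_iota ltn_ord => /(_ isT) /allP /(_ j).
by rewrite mem_iota ltn_ord => /(_ isT) /implyP; apply.
Qed.

Variable P : 'M[R]_8.
Hypothesis unitP : P \in unitmx.
Hypothesis diagP : forall k, k \in tau_indices ->
  invmx P *m twist k *m P = diag_mx (tau_diag_row k).

Local Notation twisted := (twisted_class tau_indices twist).

Let symT k (_ : k \in tau_indices) : (twist k)^T = twist k.
Proof. exact: rho_tau_sym. Qed.

Let invoT k (_ : k \in tau_indices) : twist k *m twist k = 1%:M.
Proof. exact: rho_tau_sq. Qed.

Let twisted_zero := twisted_eq0 unitP diagP symT tau_diag_row_sep.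
Let twisted_solve := twisted_exists unitP diagP symT tau_diag_row_sep.

Lemma rho_twist_commute g k : pi1orb g -> k \in tau_indices ->
  rho g *m twist k = twist k *m rho g.
Proof. by move=> gG _; exact: rho_tau_comm. Qed.

Lemma form_action k w (s b : seq R) (x : R8) (I : {set 'I_8}) : form_section rho k w ->
  pi1orb (diag_affine s b) ->
  (\prod_(i in I) s`_i) *: w (diag_affine s b x) I =
  rho (diag_affine s b) *m w x I *m (rho (diag_affine s b))^T.
Proof.
move=> [_ _ _ wG] gG; rewrite -pullback_diag wG // ffunE.
by rewrite (rho_inv rho_rep gG).
Qed.

Lemma form_sectionP k (w : R8 -> ext 'M[R]_8) :
  (forall I, smooth (fun x => w x I)) -> (forall x, of_degree k (w x)) ->
  (forall x I, (w x I)^T = - w x I) ->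
  (forall s b : seq R, signs s -> pi1orb (diag_affine s b) ->
    forall (x : R8) (I : {set 'I_8}), #|I| = k ->
    (\prod_(i in I) s`_i) *: w (diag_affine s b x) I =
    rho (diag_affine s b) *m w x I *m (rho (diag_affine s b))^T) ->
  form_section rho k w.
Proof.
move=> sw dw kw aw; split=> // g gG x.
have [s [b [ss gE]]] := pi1orb_diag gG.
apply/ffunP => I; rewrite [RHS]ffunE (rho_inv rho_rep gG) gE pullback_diag.
have [Ik|Ik] := eqVneq #|I| k; first by apply: aw; rewrite -?gE.
by rewrite !dw // scaler0 mulmx0 mul0mx.
Qed.

Lemma form_shift k w (j : 'I_8) (x : R8) (I : {set 'I_8}) : form_section rho k w ->
  w (x + e j) I = twist j *m w x I *m twist j.
Proof.
move=> fw; have jG : pi1orb (@tau R j.+1) by apply: pi1_tau; rewrite ltn_ord.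
rewrite /twist; transitivity (rho (tau j.+1) *m w x I *m (rho (tau j.+1))^T).
  move: jG; rewrite -tau_e tau_diag => jG; rewrite -(form_action x I fw jG).
  by rewrite big1 ?scale1r // => i _; rewrite nth_nseq ltn_ord.
by rewrite (rho_tau_sym rho_rep rho_alpha rho_beta).
Qed.

Lemma form_twisted k w I : form_section rho k w -> twisted (fun x => w x I).
Proof.
move=> fw; have [sw _ kw _] := fw; split=> [//|i x|//|j _ x]; last exact: (form_shift j x I fw).
have -> : x + 2%:R *: e i = x + e i + e i by rewrite scaler_nat mulr2n addrA.
rewrite !(form_shift _ _ _ fw) !mulmxA.
rewrite (rho_tau_sq rho_rep rho_alpha rho_beta) mul1mx -mulmxA.
by rewrite (rho_tau_sq rho_rep rho_alpha rho_beta) mulmx1.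
Qed.

Lemma solution_equivariant (s b : seq R) (c : R) F U : signs s -> pi1orb (diag_affine s b) ->
  c * c = 1 -> twisted F -> twisted U -> (forall x, laplacian U x = F x) ->
  (forall x, c *: F (diag_affine s b x) =
     rho (diag_affine s b) *m F x *m (rho (diag_affine s b))^T) ->
  forall x, c *: U (diag_affine s b x) =
     rho (diag_affine s b) *m U x *m (rho (diag_affine s b))^T.
Proof.
move=> ss gG cc.
apply: (twisted_equivariant unitP diagP symT invoT tau_diag_row_sep ss
  (rho_orth rho_rep gG)) => // k kS.
exact: rho_twist_commute.
Qed.

(* Differentiating c U o g = Ad U along e_i picks up the sign s_i. *)
Lemma pd_equivariant (s b : seq R) (c : R) (A B : 'M[R]_8) (U : R8 -> 'M[R]_8) (i : 'I_8) : smooth U ->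
  (forall x, c *: U (diag_affine s b x) = A *m U x *m B) ->
  forall x, (c * s`_i) *: pd i U (diag_affine s b x) = A *m pd i U x *m B.
Proof.
move=> sU cU x.
have E : (fun y => c *: (U \o diag_affine s b) y) = conj_mx A B \o U.
  by apply/funext => y; exact: cU.
have := congr1 (fun f => iter_partial [:: i] f x) E.
rewrite iter_partialZ; last exact: smooth_diag_affine.
rewrite iter_partial_diag_affine // iter_partial_conj_mx //.
by rewrite big_cons big_nil mulr1 scalerA.
Qed.

Lemma irreducible : flat_irreducible rho.
Proof.
move=> f [ff df]; have tf := form_twisted finset.set0 ff.
have f0 : forall x, f x finset.set0 = 0.
  apply: (twisted_zero tf) => x; rewrite /laplacian big1 // => i _.
  have -> : pd i (fun y => f y finset.set0) = fun=> 0.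
    apply/funext => y; rewrite -extd_1.
    have H := congr1 (fun h : R8 -> ext 'M[R]_8 => h y [set i]%SET) df.
    by apply: etrans H _; rewrite -[LHS]/((0 : ext 'M[R]_8) [set i]%SET) ffunE.
  by rewrite pd_cst.
apply/funext => x; apply/ffunP => I; rewrite ffunE.
have [->|I0] := eqVneq I finset.set0; first exact: f0.
by have [_ df0 _ _] := ff; rewrite df0 // cards_eq0.
Qed.

Lemma card1_set1 (I : {set 'I_8}) : #|I| = 1%N -> exists i, I = [set i]%SET.
Proof. by move=> /eqP /cards1P. Qed.

Lemma rigid : flat_infinitesimally_rigid rho.
Proof.
move=> a [fa da].
pose A (i : 'I_8) : R8 -> 'M[R]_8 := fun x => a x [set i]%SET.
have tA i : twisted (A i) by exact: form_twisted fa.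
have sA i : smooth (A i) by case: (tA i).
have pA i : periodic2 (A i) by case: (tA i).
have deg2 x : of_degree 2 (extd a x).
  by apply: extd_degree; have [] := fa.
(* Contraction with eta_n factors through the projection, so pi_7 (d a) = 0 becomes seven
   first-order equations. *)
have ca n x : (n < 7)%N -> contract (eta_ n) (extd a x) = 0.
  move=> n7; rewrite -contract_proj27 ?eta_mem // -pi27E //.
  have -> : pi27 (extd a x) = 0 by exact: (congr1 (fun h : R8 -> ext 'M[R]_8 => h x) da).
  by rewrite /contract big1 // => p _; rewrite ffunE scaler0.
pose div x : 'M[R]_8 := \sum_p pd p (A p) x.
have tdiv : twisted div.
  by apply: twisted_sum => p _; exact: twisted_pd.
have [U tU lU] := twisted_solve tdiv.
have [sU pU kU _] := tU.
have lA i x : laplacian (A i) x = pd i div x.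
  rewrite (rigid_identity sA pA ca).
  rewrite -[pd i div]/(iter_partial [:: i] div) iter_partial_sum //.
  by move=> p _; exact: smooth_pd.
have dU i x : A i x = pd i U x.
  apply/subr0_eq.
  have tD := twistedB (tA i) (twisted_pd i tU).
  apply: (twisted_zero tD) => y.
  rewrite laplacianB //; last exact: smooth_pd.
  rewrite lA laplacian_pd_mx //.
  by have -> : laplacian U = div; [exact/funext | rewrite subrr].
pose f x : ext 'M[R]_8 := [ffun I : {set 'I_8} => if I == finset.set0 then U x else 0].
have f0 x : of_degree 0 (f x) by move=> I I0; rewrite ffunE -cards_eq0 (negPf I0).
exists f.
  apply: form_sectionP.
  - move=> I; case: (eqVneq I finset.set0) => [I0|I0].
      by under eq_fun do rewrite ffunE I0 eqxx.
    by under eq_fun do rewrite ffunE (negPf I0); exact: smooth0.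
  - exact: f0.
  - by move=> x I; rewrite ffunE; case: ifP => _ //; rewrite trmx0 oppr0.
  - move=> s b ss gG x I /eqP; rewrite cards_eq0 => /eqP ->.
    rewrite !ffunE eqxx big_set0.
    apply: (solution_equivariant ss gG _ tdiv tU lU); first by rewrite mulr1.
    move=> y; rewrite scale1r /div mulmx_sumr mulmx_suml; apply: eq_bigr => p _.
    (* The sign of dx_p meets the sign from differentiating along p; their product is 1, so the
       divergence transforms as a 0-form. *)
    have := @pd_equivariant s b s`_p _ _ (A p) p (sA p) _ y.
    rewrite signs_mul // scale1r; apply=> z.
    by have := form_action z [set p]%SET fa gG; rewrite big_set1.
apply/funext => x; apply/ffunP => I; have [I1|I1] := eqVneq #|I| 1%N.
  have [i ->] := card1_set1 I1; rewrite /d_theta extd_1 -[RHS]/(A i x) dU.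
  by congr (pd i _ x); apply/funext => y; rewrite ffunE eqxx.
have [_ da1 _ _] := fa; rewrite (da1 x I I1).
exact: (extd_degree x f0).
Qed.

Lemma unobstructed : flat_unobstructed rho.
Proof.
move=> w [fw w7].
have tw I : twisted (fun x => w x I) by exact: form_twisted fw.
have /choice[V VP] I : exists U : R8 -> 'M[R]_8,
    twisted U /\ forall x, laplacian U x = w x I.
  by have [U tU lU] := twisted_solve (tw I); exists U.
have tV I : twisted (V I) by case: (VP I).
have lV I x : laplacian (V I) x = w x I by case: (VP I) => _; apply.
have sV I : smooth (V I) by case: (tV I).
(* The contraction of V with eta_n. For n >= 7 the list is empty and y n is 0, so regularity holds
   for all n. *)
pose y (n : nat) : R8 -> 'M[R]_8 := fun x =>
  \sum_(p <- eta_ n) (-1) ^+ p.1 *: V (idx_set p.2) x.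
have ty n : twisted (y n) by apply: twisted_sum => p _; exact: twistedZ.
have sy n : smooth (y n) by case: (ty n).
have py n : periodic2 (y n) by case: (ty n).
have ly n x : laplacian (y n) x = contract (eta_ n) (w x).
  rewrite laplacian_sum => [|p _]; last exact: smoothZ.
  by apply: eq_bigr => p _; rewrite laplacianZ // lV.
have eta_sum (W : lmodType R) (G : sform -> W) :
    \sum_(l <- eta_list) G l = \sum_(n <- iota 0 7) G (eta_ n).
  by rewrite (big_nth [::]).
(* The components of V are solved for independently. As w takes values in Lambda^2_7, V minus its
   projection is harmonic, so V takes values there too. *)
have VE I x : V I x = 4%:R^-1 *: \sum_(n <- iota 0 7) coef R (eta_ n) I *: y n x.
  apply/subr0_eq.
  have tS : twisted (fun x => \sum_(n <- iota 0 7) coef R (eta_ n) I *: y n x).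
    by apply: twisted_sum => n _; exact: twistedZ.
  have [sS _ _ _] := tS.
  have tD := twistedB (tV I) (twistedZ 4%:R^-1 tS).
  apply: (twisted_zero tD) => z.
  rewrite laplacianB //; last exact: smoothZ.
  rewrite laplacianZ // laplacian_sum => [|n _]; last exact: smoothZ.
  rewrite lV -{1}(Lambda27_proj27 (w7 z)) ffunE eta_sum.
  rewrite [X in _ - _ *: X](_ : _ = \sum_(n <- iota 0 7)
      coef R (eta_ n) I *: contract (eta_ n) (w z)) ?subrr //.
  by apply: eq_bigr => n _; rewrite laplacianZ // ly.
(* The factor 4 cancels the 1/4 of [VE], leaving the signed sum in [potential_terms]. V is indexed
   by unordered pairs; the sign restores V_{mj} when j < m. *)
pose b (j : 'I_8) : R8 -> 'M[R]_8 := fun x =>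
  4%:R *: \sum_(m | m != j) (-1) ^+ (j < m)%N *: pd m (V [set m; j]%SET) x.
have tb j : twisted (b j).
  apply: twistedZ; apply: twisted_sum => m _; apply: twistedZ.
  exact: twisted_pd.
pose a x : ext 'M[R]_8 := [ffun I : {set 'I_8} =>
  \sum_j (I == [set j]%SET)%:R *: b j x].
have a1 x j : a x [set j]%SET = b j x.
  rewrite ffunE (bigD1 j) //= eqxx scale1r big1 ?addr0 // => i ij.
  rewrite (_ : _ == _ = false) ?scale0r //; apply: contraNF ij => /eqP E.
  by have := finset.set11 i; rewrite -E inE.
have adeg x : of_degree 1 (a x).
  move=> I I1; rewrite ffunE big1 // => j _; case: eqP => [E|_].
    by rewrite E cards1 in I1.
  by rewrite scale0r.
have ta I : twisted (fun x => a x I).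
  have -> : (fun x => a x I) = fun x => \sum_j (I == [set j]%SET)%:R *: b j x.
    by apply/funext => x; rewrite ffunE.
  by apply: twisted_sum => j _; exact: twistedZ.
clearbody a; exists a.
  apply: form_sectionP => //.
  - by move=> I; case: (ta I).
  - by move=> x I; case: (ta I).
  - move=> s c ss gG x I /card1_set1[j ->]; rewrite (a1 x j) (a1 _ j) big_set1 /b.
    rewrite scalerA mulrC -scalerA -scalemxAr -scalemxAl; congr (_ *: _).
    rewrite scaler_sumr mulmx_sumr mulmx_suml; apply: eq_bigr => m mj.
    rewrite scalerA mulrC -scalerA -scalemxAr -scalemxAl; congr (_ *: _).
    (* The sign of dx_m /\ dx_j times that of d_m leaves the sign of dx_j, as a 1-form requires. *)
    have := @pd_equivariant s c (s`_m * s`_j) _ _ (V [set m; j]%SET) m (sV _) _ x.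
    rewrite mulrAC signs_mul // mul1r; apply=> z.
    have cc : s`_m * s`_j * (s`_m * s`_j) = 1.
      by rewrite mulrACA !signs_mul // mulr1.
    apply: (solution_equivariant ss gG cc (tw [set m; j]%SET)) => // t.
    have := form_action t [set m; j]%SET fw gG.
    by rewrite big_setU1 ?inE //= big_set1.
have cE := @surjective_identity R a y sy py _.
apply/funext => x; rewrite /pi27_d_theta /d_theta pi27E; last exact: extd_degree.
rewrite -[RHS](Lambda27_proj27 (w7 x)); apply/ffunP => K; rewrite !ffunE.
rewrite !eta_sum; congr (_ *: _); apply: eq_big_seq => n.
rewrite mem_iota => /= n7; rewrite cE ?ly // => j z j8.
rewrite a1 /b scaler_sumr /potential_terms big_flatten big_map sum_iota8 big_mkcond.
have dV I (m : 'I_8) : pd m (V I) z =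
    4%:R^-1 *: \sum_(n <- iota 0 7) coef R (eta_ n) I *: pd m (y n) z.
  have -> : V I = fun x => 4%:R^-1 *: \sum_(n <- iota 0 7) coef R (eta_ n) I *: y n x.
    by apply/funext => t; exact: VE.
  rewrite -[pd m _]/(iter_partial [:: m] _) iter_partialZ; last first.
    by apply: smooth_sum => l _; exact: smoothZ.
  rewrite iter_partial_sum; last by move=> l _; exact: smoothZ.
  by congr (_ *: _); apply: eq_bigr => l _; rewrite iter_partialZ.
apply: eq_bigr => m _; rewrite big_flatten big_map.
(* The omitted index m = j matches because no eta_n contains a pair with equal entries. *)
case: eqVneq => [->|mj].
  rewrite big1_seq // => l; rewrite mem_iota => /= l7.
  by rewrite inordK //= eta_sign_diag // big_nil.
rewrite dV !scalerA mulrAC mulfV ?pnatr_eq0 // mul1r scaler_sumr.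
apply: eq_bigr => l _; rewrite big_map /= inord_val inordK //.
move: (pd m (y l) z) => h.
have -> : [set m; o j]%SET = idx_set [:: nat_of_ord m; j].
  by rewrite idx_set2 // inord_val.
rewrite coef_eta_sign scaler_suml scaler_sumr; apply: eq_bigr => q _.
by rewrite scalerA signr_addb.
Qed.

End Cohomology.

Theorem proposition7p26 (R : realType)
    (rho : ('rV[R]_8 -> 'rV[R]_8) -> 'M[R]_8)
    (rho_rep : is_rep rho)
    (rho_alpha : rho (@alpha R) = 1%:M)
    (rho_beta : rho (@beta R) = 1%:M)
    (rho_comm : rho (@gamma R) *m rho (@delta R) = rho (@delta R) *m rho (@gamma R))
    (rho_nontrivial : rho (@gamma R) <> 1%:M \/ rho (@delta R) <> 1%:M)
    (rho_tau : simul_conj3 (rho (@tau R 4)) (rho (@tau R 5)) (rho (@tau R 8))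
       (diag8 [:: -1; -1; -1; -1; 1; 1; 1; 1])
       (diag8 [:: -1; -1; 1; 1; -1; -1; 1; 1])
       (diag8 [:: 1; -1; -1; 1; 1; -1; -1; 1])) :
  [/\ flat_irreducible rho, flat_infinitesimally_rigid rho
    & flat_unobstructed rho].
Proof.
have [P uP [E4 E5 E8]] := rho_tau.
have dP k : k \in tau_indices ->
    invmx P *m twist rho k *m P = diag_mx (tau_diag_row R k).
  case: k => k k8; rewrite inE /= !inE => /or3P[] /eqP kE; move: k8; rewrite kE => k8.
  - exact: E4.
  - exact: E5.
  - exact: E8.
split.
- exact: (irreducible rho_rep rho_alpha rho_beta uP dP).
- exact: (rigid rho_rep rho_alpha rho_beta uP dP).
- exact: (unobstructed rho_rep rho_alpha rho_beta uP dP).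
Qed.
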